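(* Let $n \geq 13$. If $G$ is a connected $n$-vertex graph with $\sigma_2(G) \geq \frac{2n-3}{3}$, i.e. $d(u)+d(v) \ge \frac{2n-3}{3}$ for every pair of distinct non-adjacent vertices $u,v$ of $G$, then $G$ contains a spanning broom.
   Context: Graphs are finite and simple. For a graph $G$, $\sigma_2(G) = \min\{d(u)+d(v) : u \neq v,\ uv \notin E(G)\}$ (if $G$ is complete the minimum is over the empty set and any lower bound on $\sigma_2(G)$ holds vacuously). A spider is a tree with at most one vertex of degree at least $3$. A broom is a spider obtained by joining the center of a star to an endpoint of a path; in other words, a spider in which all but at most one leg (path from the center to a leaf) have length $1$. In particular, paths and stars are brooms. A spanning broom of $G$ is a subgraph of $G$ that is a broom and contains all vertices of $G$. *)

(* Defs.v *)
From mathcomp Require Import all_boot all_order all_algebra.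
From mathcomp Require Import constructive_ereal.

Set Implicit Arguments.
Unset Strict Implicit.
Unset Printing Implicit Defensive.

Import Order.TTheory GRing.Theory Num.Theory.

Record sgraph (T : finType) := SGraph {
  adj : rel T;
  adj_sym : symmetric adj;
  adj_irr : irreflexive adj
}.

Section SimpleGraph.
Context {T : finType}.
Implicit Types (G H : sgraph T) (c u v x y : T) (p q s : seq T).

Definition degree G v : nat := #|[set u | adj G v u]|.

(* The minimum is taken in the extended rationals, so that it is +oo over the
   empty family (complete graphs); see sigma2_geP. *)
Definition sigma2 G : \bar rat :=
  \big[Order.min/+oo%E]_(e : T * T | (e.1 != e.2) && ~~ adj G e.1 e.2)
    ((degree G e.1 + degree G e.2)%:R%R)%:E.

Definition connected_graph G : Prop := forall x y, connect (adj G) x y.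

(* [ucycle] only requires a closed simple walk: [:: x; y] satisfies it as soon
   as xy is an edge, hence the size restriction. *)
Definition acyclic_graph G : Prop := forall s, 2 < size s -> ~ ucycle (adj G) s.

Definition is_tree G : Prop := connected_graph G /\ acyclic_graph G.

Definition is_spider G : Prop :=
  is_tree G /\ #|[set v | 3 <= degree G v]| <= 1.

(* If some vertex has degree at least 3, it is the only center; in a path,
   every vertex qualifies. *)
Definition is_center G c : Prop := forall v, 3 <= degree G v -> v = c.

(* A leg from c is given by its vertices other than c, so its length as a path
   is the size of the sequence. *)
Definition is_leg G c p : Prop :=
  [/\ p != [::], path (adj G) c p, uniq (c :: p) & degree G (last c p) = 1].

(* The center is existentially quantified because it is not determined by a
   path, which is a broom with an endpoint as its center. *)
Definition is_broom G : Prop :=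
  is_spider G /\
  exists2 c, is_center G c &
    forall p q, is_leg G c p -> is_leg G c q ->
      size p <> 1 -> size q <> 1 -> p = q.

(* H has the same vertex type as G, hence H being a subgraph amounts to the
   inclusion of edges, and H is automatically spanning. *)
Definition has_spanning_broom G : Prop :=
  exists2 H, subrel (adj H) (adj G) & is_broom H.

Lemma sigma2_geP G (r : rat) :
  (r%:E <= sigma2 G)%E <->
  (forall u v, u != v -> ~~ adj G u v ->
     (r <= (degree G u + degree G v)%:R)%R).
Proof.
rewrite /sigma2; split=> [/bigmin_geP[_ le_r] u v neq_uv nadj_uv|le_r].
  by have := le_r (u, v); rewrite /= neq_uv nadj_uv lee_fin; apply.
apply/bigmin_geP; split=> [|[u v] /= /andP[neq_uv nadj_uv]].
  exact: leey.
by rewrite lee_fin; apply: le_r.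
Qed.

End SimpleGraph.

(* Main.v *)
Require Import Defs.
From mathcomp Require Import all_boot all_order all_algebra.
From mathcomp Require Import constructive_ereal.
From mathcomp Require Import perm zify.

Set Implicit Arguments.
Unset Strict Implicit.
Unset Printing Implicit Defensive.

(** A graph has a spanning broom iff some path starting at a vertex [c] misses
    only neighbours of [c].  Let [P = v_0 .. v_(p-1)] be a longest path, and
    suppose that it misses a vertex.

    If no cycle has [p-1] vertices, take [x] outside [P] and count the positions
    [i < p-1] with [v_0 ~ v_(i+1)], [v_(p-1) ~ v_i] or [x ~ v_i]: the first case
    excludes the other two, and the Ore condition, applied to the stable set
    [{v_0, v_(p-1), x}], forces more positions satisfying the last two than
    positions satisfying none.  Hence there is an [i] with [x ~ v_i] such that
    [v_(p-1)] is adjacent to all of [v_i .. v_(p-2)].  This [i] is the last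
    position adjacent to the outside, so it depends neither on [x] nor on
    rotating the end of [P] beyond it; thus [v_i] is adjacent to every vertex off
    [v_i .. v_0].

    Otherwise let [K] be a cycle with [k = p-1] vertices.  Its complement [D] is
    stable.  A vertex [x] of [D] can be exchanged with any vertex of [K] both of
    whose neighbours on [K] are neighbours of [x] (a slot of [x]).  Let [Z] be
    [D] together with all slots, and [N(Z)] its neighbourhood: no two vertices of
    [N(Z)] are consecutive on [K], so [x] has at least [#|N(Z)| + 2 d(x) - k]
    slots.  By averaging, some [c] in [N(Z)] misses at most that many vertices
    of [Z], and then the vertices of [D] that [c] misses can be exchanged one by
    one with distinct slots adjacent to [c].  After this the cycle, cut at [c],
    and the remaining vertices form a spanning broom. *)

(** * Cyclic sequences *)

Section SeqComplements.
Context {T : finType}.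
Implicit Types (e : rel T) (s : seq T) (u v x : T).

Lemma next_cons_cons s u v : next [:: u, v & s] u = v.
Proof. by rewrite next_nth !inE eqxx /= eqxx. Qed.

Lemma next_cat_cons2 s1 s2 u v :
  uniq (s1 ++ [:: u, v & s2]) -> next (s1 ++ [:: u, v & s2]) u = v.
Proof.
move=> Us; have E := rot_size_cat s1 [:: u, v & s2].
have -> : next (s1 ++ [:: u, v & s2]) u = next (rot (size s1) (s1 ++ [:: u, v & s2])) u.
  by rewrite next_rot.
by rewrite E next_cons_cons.
Qed.

Lemma next_neq_prev s v : uniq s -> 2 < size s -> v \in s -> next s v != prev s v.
Proof.
move=> Us s_gt2 vs; case: (rot_to vs) => i s' E.
have := Us; rewrite -(rot_uniq i) E => Us'.
rewrite -(next_rot i Us) -(prev_rot i Us) E.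
have : 2 < size (v :: s') by rewrite -E size_rot.
case: s' E Us' => [|a [|b s']] // E Us' _; rewrite next_cons_cons //.
apply/eqP=> a_prev.
have: next [:: v, a, b & s'] a = v by rewrite {2}a_prev next_prev.
rewrite -(cat1s v) next_cat_cons2 // => b_v.
by move: Us'; rewrite b_v /= !inE eqxx orbT.
Qed.

End SeqComplements.

(** * Brooms from dominating paths *)

Section ParentTree.
Context {T : finType} (par : T -> T) (rk : T -> nat) (c : T).
Context (rk_par : forall v, v != c -> rk (par v) < rk v).

(** A tree is encoded by a parent map that strictly decreases a rank away from the root [c];
    connectedness and acyclicity then both come from the rank. *)
Definition parent_rel : rel T :=
  fun u v => (u != c) && (par u == v) || (v != c) && (par v == u).

Lemma parent_rel_sym : symmetric parent_rel.
Proof. by move=> u v; rewrite /parent_rel orbC. Qed.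

Lemma parent_rel_irr : irreflexive parent_rel.
Proof.
move=> u; rewrite /parent_rel orbb; apply/negP=> /andP[/rk_par + /eqP e].
by rewrite e ltnn.
Qed.

Definition parent_graph := SGraph parent_rel_sym parent_rel_irr.

(** Following parents leads down to [c]. On a cycle, both neighbours of a vertex of largest rank
    would have to be its parent, but they are distinct. *)
Lemma parent_graph_tree : is_tree parent_graph.
Proof.
split.
  have toc v : connect parent_rel v c.
    have [m] := ubnP (rk v); elim: m v => // m IHm v /ltnSE rkv.
    have [->//|vc] := eqVneq v c.
    apply: connect_trans (IHm _ (leq_trans (rk_par vc) rkv)).
    by apply: connect1; rewrite /parent_rel vc eqxx.
  move=> x y; apply: connect_trans (toc x) _.
  by rewrite (sym_connect_sym parent_rel_sym).
move=> s s_gt2 /andP[cyc Us].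
have [x0 x0s] : exists x, x \in s by case: s s_gt2 {cyc Us} => // x s; exists x;
  rewrite mem_head.
case: (@arg_maxnP _ x0 (mem s) rk x0s) => v vs v_max.
have par_v u : u \in s -> adj parent_graph v u -> u = par v.
  move=> us /orP[/andP[_ /eqP//]|/andP[uc /eqP pu]].
  by have := rk_par uc; rewrite pu ltnNge => /negP[]; apply: v_max.
have /eqP := next_neq_prev Us s_gt2 vs; apply.
rewrite (par_v (next s v)) ?mem_next ?(next_cycle cyc) //.
rewrite (par_v (prev s v)) ?mem_prev //.
by rewrite adj_sym (prev_cycle cyc).
Qed.

End ParentTree.

Section Broom.
Context {T : finType} (G : sgraph T) (c : T) (p : seq T).
Context (path_p : path (adj G) c p) (uniq_p : uniq (c :: p)).
Context (adj_c : forall y, y \notin c :: p -> adj G c y).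

(** Because of the extra [c] in front, the index of [v] in [p] points to the predecessor of [v] on
    the path [c :: p]. Vertices off the path hang from [c] and get rank 1. *)
Let par v := if v \in p then nth c (c :: p) (index v p) else c.
Let rk v := if v \in p then (index v p).+1 else v != c.

Lemma broom_rk v : v != c -> rk (par v) < rk v.
Proof.
move=> vc; rewrite /par /rk.
have cp : c \notin p by case/andP: uniq_p.
have [vp|vp] := boolP (v \in p); last by rewrite (negbTE cp) eqxx vc.
have := vp; rewrite -index_mem.
case: (index v p) => [|i] ip /=; first by rewrite (negbTE cp) eqxx.
rewrite (mem_nth _ (ltnW ip)) index_uniq ?(ltnW ip) //.
by case/andP: uniq_p.
Qed.

Let H := parent_graph broom_rk.

Lemma broom_sub : subrel (adj H) (adj G).
Proof.
have sub u v : u != c -> par u = v -> adj G u v.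
  move=> uc <-; rewrite adj_sym /par.
  have [up|up] := boolP (u \in p); last by apply: adj_c; rewrite inE negb_or uc.
  have /(pathP c) := path_p => /(_ (index u p)).
  by rewrite index_mem nth_index //; apply.
move=> u v /orP[/andP[uc /eqP]|/andP[vc /eqP]]; first exact: sub.
by rewrite adj_sym; apply: sub.
Qed.

Lemma broom_child v u : v != c -> u != c -> par u = v ->
  v \in p /\ u = nth c p (index v p).+1 /\ (index v p).+1 < size p.
Proof.
move=> vc uc; rewrite /par; have [up|] := boolP (u \in p); last by move=> _ e;
  rewrite e eqxx in vc.
have Up : uniq p by case/andP: uniq_p.
have := up; rewrite -index_mem.
case E: (index u p) => [|i] ip /= e; first by rewrite e eqxx in vc.
rewrite -e (mem_nth _ (ltnW ip)) index_uniq ?(ltnW ip) // -E nth_index //.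
by rewrite E.
Qed.

Lemma broom_degree v : v != c -> degree H v <= 2.
Proof.
move=> vc; rewrite /degree.
apply: leq_trans (_ : #|[set par v; nth c p (index v p).+1]| <= _); last first.
  by rewrite cards2; case: eqP.
apply: subset_leq_card; apply/subsetP=> u; rewrite !inE => /orP[/andP[_]|/andP[uc]].
  by rewrite eq_sym => ->.
by move=> /eqP pu; have [_ [<- _]] := broom_child vc uc pu; rewrite eqxx orbT.
Qed.

(** A leg with at least two edges cannot start at a vertex hanging from [c], which has no child. It
    starts along [p], and at each further step it cannot go back to the parent, so it follows
    [p]. *)
Lemma broom_leg q : is_leg H c q -> size q <> 1 -> q = p.
Proof.
case; case: q => // u q _ + Uq deg1 sz; rewrite /= => /andP[cu pq].
have uc : u != c by move: Uq => /= /andP[]; rewrite inE negb_or eq_sym => /andP[].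
have Up : uniq p by case/andP: uniq_p.
have cp : c \notin p by case/andP: uniq_p.
have par_in w : w \in p -> forall i, i < size p -> w = nth c p i -> par w = nth c (c ::
  p) i.
  by move=> wp i ip ew; rewrite /par wp ew index_uniq.
have pathn i : i < size q -> [/\ nth c (u :: q) i.+1 != c, i.+1 < size p,
     nth c (u :: q) i.+1 = nth c p i.+1 & nth c (u :: q) i = nth c p i].
  elim: i => [|i IHi] iq.
    have qp : adj H u (nth c q 0) by have /(pathP c)/(_ 0 iq) := pq.
    have q0c : nth c q 0 != c.
      apply: contraTN Uq => /eqP q0; rewrite /= negb_and negbK inE -q0.
      by rewrite mem_nth ?orbT.
    have pu : par u = c.
      move: cu => /orP[/andP[]|/andP[_ /eqP//]]; by rewrite eqxx.
    move: qp => /orP[/andP[_]|/andP[_ /eqP pq0]].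
      by rewrite pu => /eqP e; rewrite -e eqxx in q0c.
    have [up [e1 e2]] := broom_child uc q0c pq0.
    have iu0 : index u p = 0.
      move: pu; rewrite /par up; move: up; rewrite -index_mem.
      case: (index u p) => // k kp /= e; move: cp.
      by rewrite -e mem_nth // ltnW.
    move: e1 e2; rewrite iu0 /= => e1 e2; split=> //.
    by rewrite -iu0 nth_index.
  have [ic ip e1 e2] := IHi (ltnW iq).
  have qp : adj H (nth c q i) (nth c q i.+1).
    by have /(pathP c)/(_ i.+1 iq) := pq; rewrite /=.
  have qc : nth c q i.+1 != c.
    apply: contraTN Uq => /eqP q0; rewrite /= negb_and negbK inE -q0.
    by rewrite mem_nth ?orbT.
  have wp : nth c q i \in p by rewrite -[nth c q i]/(nth c (u :: q) i.+1) e1 mem_nth.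
  have pw : par (nth c q i) = nth c p i by rewrite (par_in _ wp i.+1).
  move: qp => /orP[/andP[_]|/andP[_ /eqP pq0]].
    rewrite pw -e2 => /eqP e.
    have : uniq (u :: q) by case/andP: Uq.
    move/(uniqP c)/(_ i i.+2); rewrite !inE /= !ltnS => H0.
    have /eqP := H0 (ltnW (ltnW iq)) iq e; rewrite ltn_eqF // ltnW.
  have [_ [e3 e4]] := broom_child ic qc pq0.
  have ii : index (nth c q i) p = i.+1.
    by rewrite -[nth c q i]/(nth c (u :: q) i.+1) e1 index_uniq.
  by rewrite ii in e3 e4.
have q_gt0 : 0 < size q by case: q sz {Uq deg1 pq pathn}.
have [_ qp' eql eql'] := pathn (size q).-1 ltac:(by rewrite prednK).
rewrite prednK // in qp' eql.
(* Before the end of [p], the last vertex of the leg would have both a predecessor and a successor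
   on [c :: p], hence degree at least 2. *)
have szq : (size q).+1 = size p.
  apply/eqP; rewrite eqn_leq qp' /= leqNgt; apply/negP => lt.
  have wp : last u q \in p by rewrite (last_nth c) eql mem_nth.
  have elast : last u q = nth c p (size q) by rewrite (last_nth c) eql.
  have lc : last u q != c by apply: contraTneq wp => ->.
  have nc : nth c p (size q).+1 != c by apply: contraTneq (mem_nth c lt) => ->.
  have : 2 <= degree H (last u q).
    have <- : #|[set nth c p (size q).-1; nth c p (size q).+1]| = 2.
      rewrite cards2 (nth_uniq c _ lt Up); last first.
        by rewrite (leq_ltn_trans (leq_pred _)).
      by rewrite ltn_eqF // ltnS leq_pred.
    apply: subset_leq_card; apply/subsetP=> w; rewrite !inE => /orP[]/eqP->; apply/orP.
      left; rewrite lc (par_in _ wp (size q)) //=.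
      by rewrite -{1}(prednK q_gt0).
    by right; rewrite nc (par_in _ (mem_nth c lt) (size q).+1) //= elast.
  by move: deg1 => /= ->.
apply: (@eq_from_nth _ c) => //= i; rewrite ltnS => iq.
have [lt|ge] := ltnP i (size q); first by case: (pathn i lt).
have -> : i = size q by apply/eqP; rewrite eqn_leq ge -ltnS szq andbT -szq ltnS.
exact: eql.
Qed.

Lemma spanning_broom_path : has_spanning_broom G.
Proof.
exists H; first exact: broom_sub.
have cen : is_center H c.
  move=> v v3; apply/eqP; apply: contraTT v3 => /broom_degree; lia.
split; last first.
  by exists c => // q1 q2 l1 l2 s1 s2; rewrite (broom_leg l1 s1) (broom_leg l2 s2).
split; first exact: parent_graph_tree.
rewrite -[leqRHS](cards1 c); apply: subset_leq_card; apply/subsetP => v.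
by rewrite !inE => v3; apply/eqP; exact: cen.
Qed.

End Broom.

(** * Paths and cycles in connected graphs *)

Section SeqPath.
Context {T : finType} (e : rel T) (e_sym : symmetric e).
Implicit Types (s : seq T) (x : T).

Lemma sorted_rev_sym s : sorted e (rev s) = sorted e s.
Proof. by rewrite rev_sorted; apply: eq_sorted => x y; rewrite e_sym. Qed.

Lemma sorted_cat_rev x0 s1 s2 : sorted e s1 -> sorted e s2 ->
  e (last x0 s1) (last x0 s2) -> sorted e (s1 ++ rev s2).
Proof.
case: s1 => [|x1 s1]; first by rewrite sorted_rev_sym.
case/lastP: s2 => [|s2 x2] /=; first by rewrite cats0.
rewrite -(sorted_rev_sym (rcons _ _)) last_rcons rev_rcons /=.
by rewrite cat_path /= => -> -> ->.
Qed.

Lemma cycle_cat_rev x0 s1 s2 : sorted e s1 -> sorted e s2 ->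
  s1 != [::] -> s2 != [::] ->
  e (last x0 s1) (last x0 s2) -> e (head x0 s1) (head x0 s2) ->
  cycle e (s1 ++ rev s2).
Proof.
move=> srt1 srt2 + + l12 h12; have := sorted_cat_rev srt1 srt2 l12.
case: s1 srt1 l12 h12 => // x1 s1 _ _; case: s2 srt2 => // x2 s2 _ /= h12 + _ _.
by rewrite rcons_path => ->; rewrite last_cat rev_cons last_rcons e_sym.
Qed.

End SeqPath.

Section Connected.
Context {T : finType} (G : sgraph T) (conn : connected_graph G).
Implicit Types (s P K : seq T) (u v x y z : T).

Definition upath s := sorted (adj G) s && uniq s.

Lemma connected_cut (X : {pred T}) x y : x \in X -> y \notin X ->
  exists u v, [/\ u \in X, v \notin X & adj G u v].
Proof.
move=> xX yX; have /connectP[s ps ey] := conn x y.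
elim: s x xX ps ey => [|z s IHs] x xX /=; first by move=> _ e; rewrite e xX in yX.
case/andP=> xz ps ey; have [zX|zX] := boolP (z \in X); first exact: IHs ps ey.
by exists x, z.
Qed.

(** The cycle is opened so that the path starts at [u], and the outside path is attached there. *)
Lemma upath_cycle K u z s : ucycle (adj G) K -> u \in K -> adj G u z ->
  path (adj G) z s -> uniq (z :: s) -> {in z :: s, forall y, y \notin K} ->
  exists2 s', upath s' & size s' = (size s + size K).+1.
Proof.
case/andP=> cycK UK uK uz ps Us sK; case: (rot_to uK) => i K' E.
exists (rev (z :: s) ++ u :: K'); last first.
  by rewrite size_cat size_rev /= -[(size K').+1]/(size (u :: K')) -E size_rot; lia.
have := cycK; rewrite -(rot_cycle i) E /= rcons_path => /andP[pK' _].
apply/andP; split.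
  rewrite -(revK (u :: K')); apply: (@sorted_cat_rev _ _ (@adj_sym _ G) u).
  - by rewrite sorted_rev_sym //; apply: adj_sym.
  - by rewrite sorted_rev_sym //; apply: adj_sym.
  by rewrite !rev_cons !last_rcons adj_sym.
rewrite cat_uniq rev_uniq Us -E rot_uniq UK andbT /=.
apply/hasPn=> y; rewrite mem_rot mem_rev => yK.
by apply/negP=> /sK; rewrite yK.
Qed.

Lemma upath_extend_cycle K x y : ucycle (adj G) K -> x \in K -> y \notin K ->
  exists2 s, upath s & size s = (size K).+1.
Proof.
move=> uK xK yK; have [u [v [uX vX uv]]] := connected_cut xK yK.
apply: (@upath_cycle K u v [::]) => //.
by move=> z; rewrite inE => /eqP->.
Qed.

(** Two further vertices can always be attached to [K]: if [y] has no neighbour on [K], some edge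
    leaves the closed neighbourhood of [K], and its inner end is off [K] but has a neighbour on
    it. *)
Lemma upath_cycle_edge K x y z : ucycle (adj G) K -> x \in K ->
  y \notin K -> z \notin K -> adj G y z ->
  exists2 s, upath s & size s = (size K).+2.
Proof.
move=> cK xK yK zK yz.
have attach u v w : u \in K -> v \notin K -> w \notin K -> adj G u v -> adj G v w ->
    exists2 s, upath s & size s = (size K).+2.
  move=> uK vK wK uv vw; apply: (@upath_cycle K u v [:: w]) => //=.
  - by rewrite vw.
  - by rewrite inE andbT; apply: contraTneq vw => ->; rewrite adj_irr.
  by move=> t; rewrite !inE => /orP[]/eqP->.
pose X := [pred v | (v \in K) || [exists u in K, adj G u v]].
have [yX|yX] := boolP (y \in X).
  move: yX; rewrite inE (negbTE yK) => /exists_inP[u uK uy].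
  exact: (attach u y z).
have xX : x \in X by rewrite inE xK.
have [v [w [vX wX vw]]] := connected_cut xX yX.
have wK : w \notin K by apply: contra wX; rewrite inE => ->.
have [vK|vK] := boolP (v \in K).
  by case/negP: wX; rewrite inE; apply/orP; right; apply/exists_inP; exists v.
move: vX; rewrite inE (negbTE vK) => /exists_inP[u uK uv].
exact: (attach u v w).
Qed.

End Connected.

(** * Counting positions along a sequence *)

Section Counting.

(** Let [i] be the last position satisfying [f]. If [g] holds somewhere after it, restricting to the
    positions before [i] loses one [f] and at least one [g], so the inequality survives; the new end
    [i] satisfies [f]. *)
Lemma ltn_sum_gap N (f g : pred nat) :
  \sum_(0 <= k < N) g k < \sum_(0 <= k < N) f k ->
  exists i j, [/\ i < j <= N, f i, (j == N) || f j &
                  forall k, i < k < j -> ~~ g k].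
Proof.
have [m] := ubnP N; elim: m N => // m IHm N /ltnSE leNm lt_gf.
have [i_ex | no_f] := boolP [exists i : 'I_N, f i]; last first.
  move: lt_gf; rewrite [X in _ < X]big_nat [X in _ < X]big1 // => k /= kN.
  by move: no_f => /existsPn/(_ (Ordinal kN)) /negbTE ->.
have fP : exists i, (i < N) && f i.
  by have /existsP[i fi] := i_ex; exists i; rewrite ltn_ord.
have fB i : (i < N) && f i -> i <= N by case/andP=> /ltnW.
case: (ex_maxnP fP fB) => i /andP[iN fi] i_max.
have [g_ex | no_g] := boolP [exists k : 'I_N, (i < k) && g k]; last first.
  exists i, N; rewrite iN leqnn eqxx; split=> // k /andP[ik kN].
  by move: no_g => /existsPn/(_ (Ordinal kN)); rewrite /= ik.
have /existsP[[k kN] /= /andP[ik gk]] := g_ex.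
have [|i' [j [/andP[ij ji] fi' fj no]]] := IHm i (leq_trans iN leNm).
  have f0 : \sum_(i.+1 <= l < N) f l = 0.
    rewrite big_nat big1 // => l /andP[il lN].
    by apply/eqP; rewrite eqb0; apply: contraL il => fl; rewrite -leqNgt i_max ?lN.
  move: lt_gf; rewrite !(@big_cat_nat _ _ _ i 0 N) ?(ltnW iN) //=.
  rewrite [\sum_(i <= _ < N) f _]big_ltn // fi f0.
  have : 0 < \sum_(i <= l < N) g l.
    rewrite (@big_cat_nat _ _ _ k) ?(ltnW ik) ?(ltnW kN) //=.
    by rewrite [X in _ + X]big_ltn // gk addnA addn1.
  by lia.
exists i', j; split=> //; first by rewrite ij (leq_trans ji (ltnW iN)).
by case/orP: fj => [/eqP-> | ->]; rewrite ?fi orbT.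
Qed.

Lemma card_nth_sum {T : finType} x0 (s : seq T) (Q : pred T) : uniq s ->
  #|[set u in s | Q u]| = \sum_(0 <= i < size s) Q (nth x0 s i).
Proof.
move=> Us; have -> : #|[set u in s | Q u]| = size (filter Q s).
  rewrite -(card_uniqP (filter_uniq Q Us)); apply: eq_card => u.
  by rewrite inE mem_filter andbC.
by rewrite size_filter -sum1_count (big_nth x0) big_mkcond.
Qed.

End Counting.

(** * No cycle one vertex shorter than a longest path *)

(** Only [b] and [c] can hold together, so the bound on the sums says that positions satisfying both
    outnumber the positions [w] satisfying none; [ltn_sum_gap] applies to these two kinds. *)
Lemma threshold_index N (a b c : pred nat) :
  (forall i, i < N -> a i -> ~~ c i) -> (forall i, i < N -> b i -> ~~ c i.+1) ->
  (forall i, i < N -> a i -> ~~ b i) -> (forall i, i.+1 < N -> b i -> ~~ a i.+1) ->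
  N < \sum_(0 <= i < N) a i + \sum_(0 <= i < N) b i + \sum_(0 <= i < N) c i ->
  exists i, [/\ i < N, c i & forall l, i <= l < N -> b l].
Proof.
move=> ac bc ab ba ltN; pose w i := ~~ [|| a i, b i | c i].
have sumE : \sum_(0 <= i < N) a i + \sum_(0 <= i < N) b i + \sum_(0 <= i < N) c i
   + \sum_(0 <= i < N) w i = N + \sum_(0 <= i < N) (b i && c i).
  rewrite (_ : N + _ = \sum_(0 <= i < N) (1 + (b i && c i))); last first.
    by rewrite big_split /= sum_nat_const_nat subn0 muln1.
  rewrite -!big_split /= big_nat [RHS]big_nat; apply: eq_bigr => i /= iN.
  have := ac i iN; have := ab i iN; rewrite /w.
  by case: (a i); case: (b i); case: (c i) => // A B; have := A isT; have := B isT.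
have : \sum_(0 <= i < N) w i < \sum_(0 <= i < N) (b i && c i) by lia.
case/ltn_sum_gap => i [j [/andP[ij jN] /andP[bi ci] fj noW]].
have iN : i < N by apply: leq_trans ij jN.
(* After a position satisfying [b], neither [a] nor [c] holds; as some predicate holds before [j],
   it is [b] again. The run cannot stop at some [j < N], where [c j] would follow [b j.-1]. *)
have run l : i <= l < j -> b l.
  elim: l => [|l IHl] /andP[il lj]; first by move: il; rewrite leqn0 => /eqP <-.
  have [<-//|il'] := eqVneq i l.+1.
  have {}il : i <= l by rewrite -ltnS ltn_neqAle il'.
  have bl : b l by apply: IHl; rewrite il ltnW.
  have lN : l.+1 < N by apply: leq_trans lj jN.
  have := noW l.+1; rewrite /w (negbTE (ba _ lN bl)) (negbTE (bc _ (ltnW lN) bl)).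
  by rewrite orbF negbK ltnS il; apply.
exists i; split=> // l ilN; apply: (run) => //.
case/orP: fj => [/eqP-> //|/andP[_ cj]].
case: j ij jN cj run {noW} => // j ij jN cj run.
have bj : b j by apply: run; rewrite -ltnS ij leqnn.
by have := bc j jN bj; rewrite cj.
Qed.

Section LongestPath.
Context {T : finType} (G : sgraph T) (conn : connected_graph G) (x0 : T).
Implicit Types (s P K : seq T) (u v x y z : T).

Definition longest P := upath G P /\ forall s, upath G s -> size s <= size P.

Lemma longest_size_gt0 P : longest P -> 0 < size P.
Proof. by case=> _ /(_ [:: x0]); apply. Qed.

Lemma longest_last P x : longest P -> x \notin P -> ~~ adj G (last x0 P) x.
Proof.
move=> lP xP; have P0 := longest_size_gt0 lP; case: lP => /andP[sP UP] maxP.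
apply/negP=> lx; suff /maxP : upath G (rcons P x) by rewrite size_rcons ltnn.
rewrite /upath rcons_uniq xP UP andbT.
by case: P sP lx P0 {xP UP maxP} => //= y s ys lx _; rewrite rcons_path ys lx.
Qed.

Lemma longest_rev P : longest P -> longest (rev P).
Proof.
case=> /andP[sP UP] maxP; split; last by rewrite size_rev.
by rewrite /upath sorted_rev_sym ?rev_uniq ?sP //; apply: adj_sym.
Qed.

Lemma size_rotation P i d : i + d < size P ->
  size (take i P ++ rev (drop (i + d) P)) = size P - d.
Proof.
by move=> iP; rewrite size_cat size_rev size_drop size_takel; lia.
Qed.

Lemma mem_rotation P i : take i P ++ rev (drop i P) =i P.
Proof. by move=> y; rewrite mem_cat mem_rev -mem_cat cat_take_drop. Qed.

Lemma last_take P i : i < size P -> last x0 (take i.+1 P) = nth x0 P i.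
Proof. by move=> iP; rewrite (take_nth x0) // last_rcons. Qed.

Lemma last_drop P i : i < size P -> last x0 (drop i P) = last x0 P.
Proof.
move=> iP; rewrite -[in RHS](cat_take_drop i P) last_cat (drop_nth x0 iP) //.
Qed.

Lemma last_rotation P i : i < size P ->
  last x0 (take i P ++ rev (drop i P)) = nth x0 P i.
Proof.
by move=> iP; rewrite (drop_nth x0) // rev_cons -rcons_cat last_rcons.
Qed.

(** Pósa rotation: the edge from the last vertex to v_i replaces the edge v_i v_(i+1), and v_(i+1)
    becomes the new end. *)
Lemma longest_rotation P i : longest P -> i.+1 < size P ->
  adj G (last x0 P) (nth x0 P i) ->
  longest (take i.+1 P ++ rev (drop i.+1 P)).
Proof.
case=> /andP[sP UP] maxP iP li; split; last first.
  by move=> s /maxP; rewrite -[X in drop X _]addn0 size_rotation ?subn0 ?addn0.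
apply/andP; split; last first.
  move: UP; rewrite -{1}(cat_take_drop i.+1 P) !cat_uniq rev_uniq => /and3P[-> /hasPn nU
    ->].
  by rewrite andbT; apply/hasPn => y; rewrite mem_rev; apply: nU.
have := sP; rewrite -{1}(cat_take_drop i.+1 P) => /cat_sorted2[st sd].
apply: (@sorted_cat_rev _ _ (@adj_sym _ G) x0) => //.
by rewrite last_take ?(ltnW iP) // last_drop // adj_sym.
Qed.

Lemma longest_last_next P x i : longest P -> i.+1 < size P -> x \notin P ->
  adj G (last x0 P) (nth x0 P i) -> ~~ adj G x (nth x0 P i.+1).
Proof.
move=> lP iP xP li; have lQ := longest_rotation lP iP li.
by rewrite adj_sym -(last_rotation iP) longest_last // mem_rotation.
Qed.

Lemma longest_head_prev P x i : longest P -> i.+1 < size P -> x \notin P ->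
  adj G (head x0 P) (nth x0 P i.+1) -> ~~ adj G x (nth x0 P i).
Proof.
move=> lP iP xP hi.
have -> : nth x0 P i = nth x0 (rev P) (size P - i.+2).+1.
  by rewrite nth_rev; [congr nth; lia | lia].
apply: longest_last_next; rewrite ?mem_rev ?size_rev //; first exact: longest_rev.
  by lia.
have -> : last x0 (rev P) = head x0 P.
  by case: P {lP iP xP hi} => //= y s; rewrite rev_cons last_rcons.
by rewrite nth_rev; [congr (adj G _ (nth _ _ _)): hi; lia | lia].
Qed.

(** The cycle goes from v_0 to v_i, jumps to the last vertex, runs back to v_(i+1+d) and closes at
    v_0, leaving out [d] vertices. It serves with [d = 0] and [d = 1]. *)
Lemma crossing_cycle P i d : upath G P -> i.+1 + d < size P ->
  adj G (last x0 P) (nth x0 P i) -> adj G (head x0 P) (nth x0 P (i.+1 + d)) ->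
  ucycle (adj G) (take i.+1 P ++ rev (drop (i.+1 + d) P)).
Proof.
case/andP=> sP UP iP li hi.
apply/andP; split.
  have iP' : i.+1 < size P by lia.
  have := sP; rewrite -{1}(cat_take_drop i.+1 P) => /cat_sorted2[st _].
  have := sP; rewrite -{1}(cat_take_drop (i.+1 + d) P) => /cat_sorted2[_ sd].
  apply: (@cycle_cat_rev _ _ (@adj_sym _ G) x0) => //.
  - by rewrite -size_eq0 size_takel // ltnW.
  - by rewrite -size_eq0 size_drop -lt0n subn_gt0.
  - by rewrite last_take ?(ltnW iP') // last_drop // adj_sym.
  rewrite (drop_nth x0) //=.
  by case: P {li UP sP iP iP' st sd} hi.
have := UP; rewrite -{1}(cat_take_drop i.+1 P) -{1}(cat_take_drop d (drop i.+1 P)).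
rewrite drop_drop [d + _]addnC => U.
have: subseq (take i.+1 P ++ drop (i.+1 + d) P) 
   (take i.+1 P ++ (take d (drop i.+1 P)) ++ drop (i.+1 + d) P).
  by rewrite cat_subseq // suffix_subseq.
move/subseq_uniq/(_ U); rewrite !cat_uniq rev_uniq => /and3P[-> /hasPn nU ->].
by rewrite andbT; apply/hasPn => y; rewrite mem_rev; apply: nU.
Qed.

Context (hdeg : forall u v, u != v -> ~~ adj G u v ->
  2 * #|T| <= 3 * (degree G u + degree G v) + 3).

(** The ends have no neighbour off [P], so an edge leaving [P] starts at an inner vertex. If the
    ends were adjacent, [P] would close to a cycle, from which a longer path arises. *)
Lemma longest_ends P x : longest P -> x \notin P ->
  2 < size P /\ ~~ adj G (last x0 P) (head x0 P).
Proof.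
move=> lP xP; have P0 := longest_size_gt0 lP.
have xe y : y \notin P -> ~~ adj G (last x0 P) y /\ ~~ adj G (head x0 P) y.
  move=> yP; split; first exact: longest_last.
  have := longest_last (longest_rev lP); rewrite -[rev P]cat0s => /(_ y).
  rewrite cat0s mem_rev => /(_ yP).
  by case: P {lP P0 yP xP} => //= z s; rewrite rev_cons last_rcons.
have hP : head x0 P \in P by case: P P0 {lP xP xe} => //= z s _; rewrite mem_head.
have sz : 2 < size P.
  have [u [v [uP vP uv]]] := connected_cut conn hP xP.
  have [le hd] := xe _ vP.
  rewrite ltnNge; apply/negP=> sP2; move: uv.
  suff [e | e] : u = head x0 P \/ u = last x0 P.
  - by rewrite e (negbTE hd).
  - by rewrite e (negbTE le).
  case: P uP sP2 {lP P0 xP xe hP vP le hd} => [|a [|b [|//]]] //=.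
  - by rewrite inE => /eqP->; left.
  - by rewrite !inE => /orP[] /eqP->; [left | right].
split=> //; apply/negP=> lh; case: lP => uP maxP.
have cyc : ucycle (adj G) P.
  case/andP: uP => sP UP; apply/andP; split=> //.
  by case: P sP lh {maxP UP hP sz xe P0 xP} => //= z s; rewrite rcons_path => -> ->.
have [s us ss] := upath_extend_cycle conn cyc hP xP.
by have := maxP _ us; rewrite ss ltnn.
Qed.

Lemma degree_longest P u : uniq P -> (forall y, y \notin P -> ~~ adj G u y) ->
  degree G u = \sum_(0 <= i < size P) adj G u (nth x0 P i).
Proof.
move=> UP uP; rewrite -(card_nth_sum x0 (adj G u) UP); apply: eq_card => y.
rewrite !inE; have [//|yP] := boolP (y \in P).
by rewrite (negbTE (uP _ yP)).
Qed.

(** Off [P], only the vertices other than [x] itself can be neighbours of [x]; this makes the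
    inequality strict. *)
Lemma degree_outside P x : uniq P -> x \notin P ->
  degree G x + size P < #|T| + \sum_(0 <= i < size P) adj G x (nth x0 P i).
Proof.
move=> UP xP; rewrite -(card_nth_sum x0 (adj G x) UP).
have sub : [set u | adj G x u] \subset
   [set u in P | adj G x u] :|: [set u | (u \notin P) && (u != x)].
  apply/subsetP=> u; rewrite !inE => xu; rewrite xu andbT.
  case: (u \in P) => //=; apply: contraTneq xu => ->; by rewrite adj_irr.
have := subset_leq_card sub; rewrite -/(degree G x) => le1.
have := leq_trans le1 (leq_card_setU _ _).
have : #|[set u | (u \notin P) && (u != x)]| + (size P).+1 = #|T|.
  have Ux : uniq (x :: P) by rewrite /= xP.
  rewrite -[(size P).+1](card_uniqP Ux).
  rewrite -[RHS](cardC [pred u | (u \notin P) && (u != x)]); congr (_ + _).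
    by apply: eq_card => u; rewrite !inE.
  by apply: eq_card => u; rewrite !inE negb_and !negbK orbC.
lia.
Qed.

Lemma longest_pivot P x : longest P -> x \notin P ->
  (forall K, ucycle (adj G) K -> 2 < size K -> size K != (size P).-1) ->
  exists i, [/\ i < (size P).-1, adj G x (nth x0 P i) &
    forall l, i <= l < (size P).-1 -> adj G (last x0 P) (nth x0 P l)].
Proof.
move=> lP xP nocyc; have [sz nlh] := longest_ends lP xP.
have uP := lP.1; have /andP[sP UP] := uP.
have lastE : last x0 P = nth x0 P (size P).-1 by rewrite nth_last.
have headE : head x0 P = nth x0 P 0 by rewrite nth0.
have ltP : (size P).-1 < size P by lia.
have gtP : 0 < size P by lia.
have lastP : last x0 P \in P by rewrite lastE mem_nth.
have headP : head x0 P \in P by rewrite headE mem_nth.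
have hout y : y \notin P -> ~~ adj G (head x0 P) y.
  have := longest_last (longest_rev lP) (x := y); rewrite mem_rev.
  have -> // : last x0 (rev P) = head x0 P.
  by case: P {lP uP sP UP nocyc nlh xP sz lastE headE lastP headP ltP gtP} => //= z s;
    rewrite rev_cons last_rcons.
have lout y : y \notin P -> ~~ adj G (last x0 P) y by apply: longest_last.
have dh := degree_longest UP hout; have dl := degree_longest UP lout.
have dx := degree_outside UP xP.
have ne1 : last x0 P != head x0 P.
  by rewrite lastE headE (nth_uniq x0 ltP gtP UP); lia.
have ne2 : last x0 P != x by apply: contraNneq xP => <-.
have ne3 : head x0 P != x by apply: contraNneq xP => <-.
have h1 := hdeg ne1 nlh; have h2 := hdeg ne2 (lout _ xP); have h3 := hdeg ne3 (hout _ xP).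
set N := (size P).-1; have EN : size P = N.+1 by rewrite /N; lia.
rewrite EN in dh dl dx sz.
(* All three sums are brought to [N] positions: index 0 is dropped for v_0, and the last index for
   the two others. *)
rewrite big_nat_recl // -headE adj_irr add0n in dh.
rewrite big_nat_recr //= -/N in dl; rewrite big_nat_recr //= in dx.
rewrite -lastE adj_irr addn0 in dl.
rewrite -lastE [adj G x _]adj_sym (negbTE (lout _ xP)) addn0 in dx.
apply: (@threshold_index N (fun i => adj G (head x0 P) (nth x0 P i.+1))
  (fun i => adj G (last x0 P) (nth x0 P i)) (fun i => adj G x (nth x0 P i))).
- by move=> i iN; apply: longest_head_prev => //; rewrite EN.
- by move=> i iN; apply: longest_last_next => //; rewrite EN.
(* Both edges would give a cycle through all of [P], which extends to a longer path. *)
- move=> i iN ai; apply/negP=> bi.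
  have iP : i.+1 + 0 < size P by rewrite addn0 EN.
  have cyc := crossing_cycle uP iP bi; rewrite addn0 in cyc; have {}cyc := cyc ai.
  have hK : head x0 P \in take i.+1 P ++ rev (drop i.+1 P) by rewrite mem_rotation.
  have xK : x \notin take i.+1 P ++ rev (drop i.+1 P) by rewrite mem_rotation.
  have [s us] := upath_extend_cycle conn cyc hK xK.
  rewrite -[X in drop X _]addn0 size_rotation // subn0 => ss.
  by have := lP.2 _ us; rewrite ss ltnn.
(* Here the crossing cycle leaves out v_(i+1) only, so it has the excluded length. Its length
   exceeds 2 because [i = 0] would make the ends adjacent. *)
- move=> i iN bi; apply/negP=> ai.
  have iP : i.+1 + 1 < size P by rewrite addn1 EN.
  have := crossing_cycle uP iP bi; rewrite addn1 => /(_ ai) cyc.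
  have szK : size (take i.+1 P ++ rev (drop i.+2 P)) = N.
    by rewrite -[i.+2]addn1 size_rotation // subn1.
  suff N_gt2 : 2 < N by have := nocyc _ cyc; rewrite szK eqxx N_gt2 => /(_ isT).
  rewrite (leq_ltn_trans _ iN) // ltnS lt0n.
  by apply: contraNneq nlh => i0; rewrite headE -i0.
(* Adding the three Ore inequalities bounds the sum of the three degrees below by n - 1. At most n -
   p - 1 neighbours of [x] are off [P], so the three counts add up to at least p = N + 1. *)
rewrite -dh -dl; move: (\sum_(0 <= i < N) _) dx h1 h2 h3 => S; move: (degree G _) => dX;
  move: (degree G _) (degree G _) => dH dL; move: #|T| => n; clear; lia.
Qed.

End LongestPath.

Lemma nth_rotation {T : Type} (x0 : T) P k j : k < size P -> j < size P ->
  nth x0 (take k P ++ rev (drop k P)) j =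
  nth x0 P (if j < k then j else size P - (j - k).+1).
Proof.
move=> kP jP; rewrite nth_cat size_take kP; case: ifPn => jk; first by rewrite nth_take.
rewrite -leqNgt in jk.
rewrite nth_rev size_drop ?ltn_sub2r // nth_drop; congr nth; lia.
Qed.

Lemma broom_of_longest_path {T : finType} (G : sgraph T) P x :
  connected_graph G ->
  (forall u v, u != v -> ~~ adj G u v ->
     2 * #|T| <= 3 * (degree G u + degree G v) + 3) ->
  longest G P -> x \notin P ->
  (forall K, ucycle (adj G) K -> 2 < size K -> size K != (size P).-1) ->
  has_spanning_broom G.
Proof.
move=> conn hdeg lP xP nocyc.
have [i [iN xi bi]] := longest_pivot conn x hdeg lP xP nocyc.
have iP : i.+1 < size P by move: iN; case: (size P).
(* Every vertex after the pivot follows a neighbour of the last vertex, so it has no neighbour off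
   the path. *)
have above Q y j l : longest G Q -> y \notin Q -> j < l -> l < size Q ->
   (forall l, j <= l < (size Q).-1 -> adj G (last x Q) (nth x Q l)) ->
   ~~ adj G y (nth x Q l).
  move=> lQ yQ; case: l => // l jl lQs; move/(_ l) => bl.
  by apply: longest_last_next => //; apply: bl;
    rewrite -ltnS jl -ltnS prednK // (leq_trans _ lQs).
have yi y : y \notin P -> adj G y (nth x P i).
  move=> yP; have [iy [iyN yiy biy]] := longest_pivot conn x hdeg lP yP nocyc.
  have iyP : iy.+1 < size P by move: iyN; case: (size P).
  have [lt|gt|->//] := ltngtP i iy.
  - by have := above P y i iy lP yP lt (ltnW iyP) bi; rewrite yiy.
  - by have := above P x iy i lP xP gt (ltnW iP) biy; rewrite xi.
(* Rotating at [k = l - 1] makes v_l the end. The pivot [j] of the rotated path is at most [i],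
   since beyond position [i] both paths have the same vertices, none adjacent to [x]. Hence the new
   end is adjacent to v_i. *)
have li l : i < l -> l < size P -> adj G (nth x P i) (nth x P l).
  case: l => // k; rewrite ltnS => ik kP.
  have lk : adj G (last x P) (nth x P k) by apply: bi;
    rewrite ik -ltnS prednK // (leq_trans _ kP).
  have lQ := longest_rotation lP kP lk; set Q := _ ++ _ in lQ.
  have szQ : size Q = size P by rewrite /Q -[X in drop X _]addn0 size_rotation ?subn0
    ?addn0.
  have xQ : x \notin Q by rewrite mem_rotation.
  have nocycQ K : ucycle (adj G) K -> 2 < size K -> size K != (size Q).-1 by rewrite szQ;
    apply: nocyc.
  have [j [jN xj bj]] := longest_pivot conn x hdeg lQ xQ nocycQ.
  have Qi : nth x Q i = nth x P i by rewrite nth_rotation ?(ltnW iP) // ltnS ik.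
  have jP : j < size P by move: jN; rewrite szQ; move: (size P) => p; clear; lia.
  have ji : j <= i.
    rewrite leqNgt; apply/negP=> ij; move: xj; rewrite nth_rotation //.
    apply/negP; apply: (above P x i) => //.
    - by case: ifP => // _; move: ij ik kP jP; move: (size P) => p; clear; lia.
    - by case: ifP => // _; move: ij ik kP jP; move: (size P) => p; clear; lia.
  rewrite adj_sym -Qi -(last_rotation x kP); apply: bj.
  by rewrite ji szQ.
have take_i : rcons (take i P) (nth x P i) = take i.+1 P by rewrite -take_nth // ltnW.
have [/andP[sP UP] _] := lP.
have mem_c y : (y \in nth x P i :: rev (take i P)) = (y \in take i.+1 P).
  by rewrite -take_i mem_rcons !inE mem_rev.
(* The handle of the broom is v_i, v_(i-1), ..., v_0. *)
apply: (@spanning_broom_path _ _ (nth x P i) (rev (take i P))).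
- rewrite -[path _ _ _]/(sorted (adj G) (nth x P i :: rev (take i P))).
  rewrite -rev_rcons take_i sorted_rev_sym; last exact: adj_sym.
  exact: take_sorted.
- by rewrite -rev_rcons take_i rev_uniq take_uniq.
move=> y; rewrite mem_c => yi'; have [yP|yP] := boolP (y \in P); last first.
  by rewrite adj_sym yi.
rewrite -(nth_index x yP); apply: li; last by rewrite index_mem.
rewrite ltnNge; apply: contra yi' => yi'.
by rewrite in_take.
Qed.

(** * Successors and predecessors on a cycle *)

Section SeqPathComplements.
Context {T : finType}.
Implicit Types (e : rel T) (s : seq T) (u v x : T).

Lemma path_rev_cons e x y s : symmetric e ->
  path e x (rev (y :: s)) = path e y (rcons s x).
Proof.
move=> e_sym; rewrite -[LHS]/(sorted e (x :: rev (y :: s))) -rev_rcons.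
by rewrite sorted_rev_sym.
Qed.

Lemma next_head w s : next (w :: s) w = head w s.
Proof. by rewrite next_nth inE eqxx /= eqxx; case: s. Qed.

Lemma next_last_head s u v : uniq (v :: rcons s u) -> next (v :: rcons s u) u = v.
Proof.
rewrite -rcons_cons => U; rewrite -(next_rotr 1 U) rotr1_rcons.
exact: next_cons_cons.
Qed.

Lemma prev_head w s : uniq (w :: s) -> prev (w :: s) w = last w s.
Proof.
case/lastP: s => [_|s u U]; first by rewrite prev_nth inE eqxx.
by rewrite last_rcons -{2}(next_last_head U) prev_next.
Qed.

Lemma prev_cat s1 b r w s2 : uniq (s1 ++ (b :: r) ++ w :: s2) ->
  prev (s1 ++ (b :: r) ++ w :: s2) w = last b r.
Proof.
rewrite lastI cat_rcons catA => U.
by rewrite -{2}(next_cat_cons2 U) prev_next.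
Qed.

End SeqPathComplements.

(** The minimum over [A] is at most the average; the pairs are counted from both sides. *)
Lemma exists_leq_average {T : finType} (r : rel T) (A B : {set T}) : A != set0 ->
  exists2 a, a \in A &
    #|A| * #|[set b in B | r a b]| <= \sum_(b in B) #|[set a in A | r a b]|.
Proof.
case/set0Pn=> a0 a0A.
case: (@arg_minnP _ a0 (mem A) (fun a => #|[set b in B | r a b]|) a0A) => a aA a_min.
exists a => //; have -> : \sum_(b in B) #|[set a in A | r a b]| = \sum_(a in A) #|[set b
  in B | r a b]|.
  under eq_bigr do rewrite -sum1dep_card big_mkcondr /=.
  rewrite exchange_big /=; apply: eq_bigr => a' _.
  by rewrite -big_mkcondr sum1dep_card.
by rewrite -sum_nat_const; apply: leq_sum => a' a'A; apply: a_min.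
Qed.

(* [t = #|N(Z)|], [z = #|Z|], [q]: number of vertices of [Z] missed by the centre,
   [f] and [d]: number of slots and degree of a vertex off the cycle, [sd]: sum of
   the degrees over [Z]. *)
Lemma swap_count_generic n k s t z q f d sd : 2 * n <= 3 * s + 3 -> k.+2 <= n ->
  2 * t <= k -> z + k <= n + t -> 0 < z -> t * q + sd <= z * t -> z * s <= 2 * sd ->
  t + 2 * d <= k + f -> s <= 2 * d -> q <= f.
Proof.
move=> ns kn tk zk z0 tq zs tf sd2; rewrite leqNgt; apply/negP=> fq.
(* The excess e = 2t - s is nonnegative because the degree sum [sd] is at most [z * t]. *)
have [e ee] : exists e, 2 * t = s + e.
  exists (2 * t - s); suff : s <= 2 * t by lia.
  rewrite leqNgt; apply/negP=> ts.
  have : z * (2 * t) < z * s by rewrite ltn_mul2l z0.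
  nia.
have [M eM] : exists M, n = k + M.+2 by exists (n - k - 2); lia.
have h1 : 2 * t * q <= z * e by nia.
have h2 : z * e <= (M.+2 + t) * e by rewrite leq_mul2r; lia.
(* From q > f, f >= t + 2d - k, 2d >= s and 3s >= 2n - 3. *)
have h3 : e + 2 * M + 3 <= 2 * q by lia.
have h4 : t * (e + 2 * M + 3) <= t * (2 * q) by rewrite leq_mul2l h3 orbT.
(* The bounds so far give t(2M + 3) <= (M + 2)e, and e <= t leaves 2M + 3 <= M + 2, which is
   absurd. *)
have h5 : e <= t by lia.
have : t * (2 * M + 3) <= M.+2 * e by nia.
have : M.+2 * e <= M.+2 * t by rewrite leq_mul2l h5 orbT.
have : 0 < t by lia.
nia.
Qed.

(* Here the centre is a neighbour of a vertex of degree [d0] that has no slot. *)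
Lemma swap_count_low n k s t z q f d d0 y : 2 * n <= 3 * s + 3 -> k.+2 <= n ->
  2 * t <= k -> z + k <= n + t -> t + 2 * d0 <= k -> y + s = t + d0 -> 0 < d0 ->
  d0 * q <= z.-1 * y -> t + 2 * d <= k + f -> s <= d + d0 -> q <= f.
Proof.
move=> ns kn tk zk td0 ys d0_gt0 dq tf sd; rewrite leqNgt; apply/negP=> fq.
have [M eM] : exists M, n = k + M.+2 by exists (n - k - 2); lia.
(* With y = t + d0 - s, the first bound uses t + 2 d0 <= k and the second 2t <= k. The product of
   the two exceeds 3(M + 1 + t)y, which is an upper bound for 3 d0 q. *)
have h1 : 4 * y + 4 * M + 3 <= q by lia.
have h2 : 3 * y + t + 2 * M + 1 <= 3 * d0 by lia.
have h3 : (3 * y + t + 2 * M + 1) * (4 * y + 4 * M + 3) <= 3 * d0 * q by rewrite leq_mul.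
have h4 : z.-1 * y <= (M.+1 + t) * y by rewrite leq_mul2r; lia.
nia.
Qed.

(** * A cycle one vertex shorter than a longest path *)

Section NearLongestCycle.
Context {T : finType} (G : sgraph T) (conn : connected_graph G) (k : nat).
Context (k_gt2 : 2 < k) (k_lt : k.+1 < #|T|).
Context (short : forall s, upath G s -> size s <= k.+1).
Implicit Types (K s : seq T) (c u v w x y z : T).

Definition kcycle K := ucycleb (adj G) K && (size K == k).

(** An outside vertex attached to such a cycle would give a path on k + 2 vertices. *)
Lemma no_longer_cycle K : ucycle (adj G) K -> size K = k.+1 -> False.
Proof.
move=> cK szK; have [y yK] : exists y, y \notin K.
  apply/existsP; rewrite -negb_forall; apply/negP=> /forallP allK.
  have : #|T| <= size K.
    by apply: leq_trans (card_size K); apply/subset_leq_card/subsetP => y _; apply: allK.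
  by rewrite szK leqNgt k_lt.
have [x xK] : exists x, x \in K by case: K szK {cK yK} => // x K _; exists x;
  rewrite mem_head.
have [s us ss] := upath_extend_cycle conn cK xK yK.
by have := short us; rewrite ss szK ltnn.
Qed.

Lemma kcycle_rev K : kcycle K -> kcycle (rev K).
Proof.
case/andP=> /andP[cK UK] szK; rewrite /kcycle size_rev szK andbT.
rewrite /ucycleb rev_uniq UK andbT rev_cycle.
by rewrite (eq_cycle (e' := adj G)) // => x y; rewrite adj_sym.
Qed.

Lemma kcycle_uniq K : kcycle K -> uniq K.
Proof. by case/andP=> /andP[]. Qed.

Lemma kcycle_rot K w : kcycle K -> w \in K -> exists s,
  [/\ kcycle (w :: s), K =i w :: s, next K =1 next (w :: s) & prev K =1 prev (w :: s)].
Proof.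
move=> gK wK; have UK := kcycle_uniq gK; case: (rot_to wK) => i s E; exists s; rewrite -E.
split=> [|y|y|y]; last 3 first.
- by rewrite mem_rot.
- by rewrite next_rot.
- by rewrite prev_rot.
by move: gK; rewrite /kcycle /ucycleb rot_cycle rot_uniq size_rot.
Qed.

Lemma kcycle_outside K y z : kcycle K -> y \notin K -> z \notin K -> ~~ adj G y z.
Proof.
case/andP=> cK /eqP szK yK zK; apply/negP=> yz.
have [x xK] : exists x, x \in K.
  by case: K szK {cK yK zK} => [e|x K _]; [move: k_gt2; rewrite -e | exists x;
    rewrite mem_head].
have [s us ss] := upath_cycle_edge conn cK xK yK zK yz.
by have := short us; rewrite ss szK ltnn.
Qed.

(** If z = z', inserting it between [u] and its successor gives a cycle on k + 1 vertices. Otherwise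
    the cycle is opened there and [z], [z'] prolong the path at both ends. *)
Lemma kcycle_consecutive K z z' u : kcycle K -> z \notin K -> z' \notin K ->
  u \in K -> adj G z u -> adj G z' (next K u) -> False.
Proof.
move=> gK zK z'K uK zu z'u.
have [s [gs Ks nexts _]] := kcycle_rot gK uK.
rewrite nexts in z'u; rewrite Ks in zK; rewrite Ks in z'K.
case/andP: gs => /andP[cs Us] /eqP szs.
case: s cs Us szs zK z'K z'u {Ks nexts} => [|v s] /= cs Us szs zK z'K;
  first by move: k_gt2; rewrite -szs.
rewrite eqxx => z'v.
have pvs : path (adj G) v (rcons s u) by case/andP: cs.
have Uvs : uniq (v :: rcons s u) by rewrite -rcons_cons rcons_uniq.
have zvs : z \notin v :: rcons s u by rewrite -rcons_cons mem_rcons.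
have z'vs : z' \notin v :: rcons s u by rewrite -rcons_cons mem_rcons.
have [zz'|zz'] := eqVneq z z'.
  apply: (@no_longer_cycle [:: z, v & rcons s u]); last by rewrite /= size_rcons szs.
  rewrite /ucycle cons_uniq zvs Uvs /= rcons_path pvs last_rcons [adj G u _]adj_sym zu.
  by rewrite zz' z'v.
have : upath G [:: z', v & rcons (rcons s u) z].
  apply/andP; split; first by rewrite /= z'v rcons_path pvs last_rcons adj_sym.
  rewrite (perm_uniq (_ : perm_eq _ [:: z', z, v & rcons s u])); last first.
    by rewrite perm_cons -rcons_cons perm_rcons.
  by rewrite 2!cons_uniq Uvs zvs inE negb_or eq_sym zz' z'vs.
by move/short; rewrite /= !size_rcons szs ltnn.
Qed.

(* For [x] outside [K], such a [w] can be exchanged with [x]. *)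
Definition slot K x w := [&& w \in K, adj G x (prev K w) & adj G x (next K w)].

Lemma slot_rev K x w : uniq K -> slot (rev K) x w = slot K x w.
Proof. by move=> UK; rewrite /slot mem_rev next_rev // prev_rev // [adj G x _ && _]andbC.
  Qed.

Lemma slot_outside K x w y : kcycle K -> x \notin K -> slot K x w -> y \notin K ->
  ~~ adj G w y.
Proof.
move=> gK xK /and3P[wK xp xn] yK; apply/negP=> wy.
apply: (@kcycle_consecutive K x y (prev K w)) => //; first by rewrite mem_prev.
by rewrite next_prev ?kcycle_uniq // adj_sym.
Qed.

(** Mapping a transposition over the cycle lets [next] and [prev] commute with the exchange. *)
Definition swap w x K := [seq tperm w x v | v <- K].

Lemma mem_swap K w x v : w \in K -> x \notin K ->
  (v \in swap w x K) = (v == x) || (v != w) && (v \in K).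
Proof.
move=> wK xK; rewrite /swap -[v in LHS](tpermK w x) mem_map; last exact: perm_inj.
case: tpermP => [-> | -> | /eqP vw /eqP vx].
- by rewrite (negbTE xK) eqxx /= orbF; apply/esym/negbTE; apply: contraNneq xK => <-.
- by rewrite eqxx wK.
by rewrite vw (negbTE vx).
Qed.

Lemma next_swap K w x v : uniq K -> x \notin K -> v \in K -> v != w -> next K v != w ->
  next (swap w x K) v = next K v.
Proof.
move=> UK xK vK vw nw.
have vx : v != x by apply: contraNneq xK => <-.
have nx : next K v != x by apply: contraNneq xK => <-; rewrite mem_next.
rewrite -{1}[v](tpermD (x := w) (y := x)) 1?eq_sym //.
by rewrite next_map ?tpermD 1?eq_sym //; apply: perm_inj.
Qed.

Lemma prev_swap K w x v : uniq K -> x \notin K -> v \in K -> v != w -> prev K v != w ->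
  prev (swap w x K) v = prev K v.
Proof.
move=> UK xK vK vw nw.
have vx : v != x by apply: contraNneq xK => <-.
have nx : prev K v != x by apply: contraNneq xK => <-; rewrite mem_prev.
rewrite -{1}[v](tpermD (x := w) (y := x)) 1?eq_sym //.
by rewrite prev_map ?tpermD 1?eq_sym //; apply: perm_inj.
Qed.

Lemma kcycle_swap K w x : kcycle K -> x \notin K -> slot K x w -> kcycle (swap w x K).
Proof.
move=> gK xK /and3P[wK xp xn]; have UK := kcycle_uniq gK.
case/andP: (gK) => /andP[cK _] /eqP szK.
have US : uniq (swap w x K) by rewrite map_inj_uniq //; apply: perm_inj.
rewrite /kcycle size_map szK eqxx andbT /ucycleb US andbT.
apply: cycle_from_next => // _ /mapP[v vK ->].
rewrite next_map //; last exact: perm_inj.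
have vx : v != x by apply: contraNneq xK => <-.
have nx : next K v != x by apply: contraNneq xK => <-; rewrite mem_next.
have vn := next_cycle cK vK.
have [vw|vw] := eqVneq v w.
  subst v; rewrite tpermL tpermD // 1?eq_sym //.
  by apply: contraTneq vn => ->; rewrite adj_irr.
rewrite (@tpermD _ w x v) 1?eq_sym //.
have [nw|nw] := eqVneq (next K v) w; last by rewrite tpermD 1?eq_sym.
by rewrite nw tpermL adj_sym; move: xp; rewrite -nw prev_next.
Qed.

Lemma no_insertion K x s : kcycle K -> x \notin K -> perm_eq s (x :: K) ->
  cycle (adj G) s -> False.
Proof.
move=> /andP[/andP[_ UK] /eqP szK] xK sK cs.
apply: (@no_longer_cycle s); last by rewrite (perm_size sK) /= szK.
by apply/andP; rewrite cs (perm_uniq sK) /= xK UK.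
Qed.

(** Normal form for rerouting [K]: from [w] one arc leads to [u], and the other starts at the
    successor [b] of [u]. *)
Lemma kcycle_split K w u : kcycle K -> w \in K -> u \in K -> u != w ->
  next K u != w -> exists a s b t,
  [/\ kcycle (w :: (a :: s) ++ b :: t), perm_eq K (w :: (a :: s) ++ b :: t),
      next K =1 next (w :: (a :: s) ++ b :: t), prev K =1 prev (w :: (a :: s) ++ b :: t) &
      last a s = u].
Proof.
move=> gK wK uK uw nuw; have [r [gr Kr nexts prevs]] := kcycle_rot gK wK.
have Kpr : perm_eq K (w :: r).
  by apply: uniq_perm => //; [apply: kcycle_uniq gK | apply: kcycle_uniq gr].
rewrite nexts in nuw; rewrite Kr inE (negbTE uw) /= in uK.
case/splitPr: uK gr Kpr nexts prevs nuw {Kr} => s [|b t] gr Kpr nexts prevs nuw.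
  move: nuw (kcycle_uniq gr); rewrite cats1 => nuw Ur.
  by rewrite next_last_head ?eqxx in nuw.
have [a [s' E]] : exists a s', rcons s u = a :: s'.
  by case: (s) => [|a s']; [exists u, [::] | exists a, (rcons s' u)].
exists a, s', b, t; move: gr Kpr nexts prevs; rewrite -cat_rcons E => gr Kpr nexts prevs.
by split=> //; rewrite -[LHS]/(last u (a :: s')) -E last_rcons.
Qed.

Lemma no_slot_outside K x w u : kcycle K -> x \notin K -> slot K x w ->
  u \in K -> adj G w u -> adj G x (next K u) -> False.
Proof.
move=> gK xK sw uK wu xu; case/and3P: (sw) => wK xp xn.
have nuw : next K u != w by apply: contraTneq (slot_outside gK xK sw xK) => <-;
  rewrite adj_sym xu.
have uw : u != w by apply: contraTneq wu => ->; rewrite adj_irr.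
have [a [s [b [t [gs Ks nexts prevs lu]]]]] := kcycle_split gK wK uK uw nuw.
have Us := kcycle_uniq gs; case/andP: (gs) => /andP[cs _] _.
have nub : next K u = b.
  by rewrite nexts -lu; move: Us; rewrite (lastI a s) cat_rcons -cat_cons;
    apply: next_cat_cons2.
rewrite nub in xu; rewrite nexts next_head /= in xn.
rewrite prevs prev_head //= last_cat /= in xp.
(* The cycle x, b, ..., prev w, w, u, then backwards to a = next w, and x. *)
apply: (@no_insertion K x (x :: (b :: t) ++ w :: rev (a :: s))) => //.
  rewrite perm_cons perm_sym; apply: perm_trans Ks _.
  by apply/seq.permP=> p; rewrite /= !count_cat /= count_rev /=; clear; lia.
move: cs; rewrite /= !rcons_path !cat_path !last_cat /= => /andP[wa /andP[/andP[as_
  /andP[ab tt]] tw]].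
rewrite xu tt tw path_rev_cons; last exact: adj_sym.
by rewrite rcons_path as_ lu [adj G u w]adj_sym wu rev_cons last_rcons adj_sym xn.
Qed.

Lemma no_slot_slot K x w w' : kcycle K -> x \notin K -> slot K x w -> slot K x w' ->
  ~~ adj G w w'.
Proof.
move=> gK xK sw sw'; apply/negP=> ww'.
case/and3P: (sw) => wK xp xn; case/and3P: (sw') => w'K xp' xn'.
have nw'w : next K w' != w.
  by apply: contraTneq (slot_outside gK xK sw xK) => <-; rewrite adj_sym xn'.
have nww' : next K w != w'.
  by apply: contraTneq (slot_outside gK xK sw' xK) => <-; rewrite adj_sym xn.
have w'w : w' != w by apply: contraTneq ww' => ->; rewrite adj_irr.
have [a [s [b [t [gs Ks nexts prevs lu]]]]] := kcycle_split gK wK w'K w'w nw'w.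
have Us := kcycle_uniq gs; case/andP: (gs) => /andP[cs _] _.
have nub : next K w' = b.
  by rewrite nexts -lu; move: Us; rewrite (lastI a s) cat_rcons -cat_cons;
    apply: next_cat_cons2.
rewrite nub in xn'; rewrite nexts next_head /= in xn.
case/lastP: s lu gs Ks nexts prevs Us cs => [|s v]; rewrite ?last_rcons.
  by move=> /= aw' gs Ks nexts; move: nww'; rewrite nexts next_head /= aw' eqxx.
move=> -> gs Ks nexts prevs Us cs.
(* The cycle x, next w, ..., w', w, prev w, then backwards to b = next w', and x. *)
apply: (@no_insertion K x (x :: (a :: s) ++ w' :: w :: rev (b :: t))) => //.
  rewrite perm_cons perm_sym; apply: perm_trans Ks _.
  apply/seq.permP=> p; rewrite /= !count_cat /= -cats1 !count_cat count_rev /=; clear; lia.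
move: cs; rewrite /= rcons_cat cat_path rcons_path last_rcons /= => /and3P[wa /andP[as_
  sw'_] /andP[w'b tw]].
rewrite xn rcons_cat cat_path as_ /= sw'_ adj_sym ww' /= rcons_path path_rev_cons;
  last exact: adj_sym.
by rewrite tw rev_cons last_rcons adj_sym xn'.
Qed.

Lemma no_slot_slot_consecutive K x w w' u : kcycle K -> x \notin K ->
  slot K x w -> slot K x w' -> w != w' ->
  u \in K -> adj G w u -> adj G w' (next K u) -> False.
Proof.
move=> gK xK sw sw' nww' uK wu w'u.
case/and3P: (sw) => wK xp xn; case/and3P: (sw') => w'K xp' xn'.
have nww := no_slot_slot gK xK sw sw'.
have uw : u != w by apply: contraTneq wu => ->; rewrite adj_irr.
have uw' : u != w' by apply: contraTneq wu => ->.
have nuw : next K u != w by apply: contraTneq w'u => ->; rewrite adj_sym.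
have nuw' : next K u != w' by apply: contraTneq w'u => ->; rewrite adj_irr.
have [a [s [b [t [gs Ks nexts prevs lu]]]]] := kcycle_split gK wK uK uw nuw.
have Us := kcycle_uniq gs; case/andP: (gs) => /andP[cs _] _.
have nub : next K u = b.
  by rewrite nexts -lu; move: Us; rewrite (lastI a s) cat_rcons -cat_cons;
    apply: next_cat_cons2.
rewrite nub in w'u nuw'; rewrite nexts next_head /= in xn.
rewrite prevs prev_head //= last_cat /= in xp.
have : (w' \in a :: s) || (w' \in t).
  have := w'K; rewrite (perm_mem Ks) inE eq_sym (negbTE nww') /= -cat_cons mem_cat.
  by rewrite [w' \in b :: t]inE eq_sym (negbTE nuw').
move: cs xn lu; rewrite -[last a s]/(last w (a :: s)) => cs xn lu.
case/orP=> [w's|w't].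
  have [r1 [r2 E]] : exists r1 r2, a :: s = r1 ++ w' :: r2.
    by case/splitPr: w's => r1 r2; exists r1, r2.
  rewrite E in gs Ks nexts Us cs lu;
    case: r2 E gs Ks nexts Us cs lu => [|c r2] _ gs Ks nexts Us cs lu.
    by rewrite -lu last_cat eqxx in uw'.
  have nw' : next K w' = c.
    by rewrite nexts; move: Us; rewrite -catA => Us;
      exact: (@next_cat_cons2 _ (w :: r1) (r2 ++ b :: t)).
  rewrite nw' in xn'; rewrite last_cat /= in lu.
  (* With [w'] between [w] and [u]: x, next w', ..., u, w, next w, ..., w', b, ..., prev w, x. *)
  apply: (@no_insertion K x (x :: (c :: r2) ++ w :: r1 ++ w' :: b :: t)) => //.
    rewrite perm_cons perm_sym; apply: perm_trans Ks _.
    by apply/seq.permP=> p; rewrite /= !count_cat /= !count_cat /=; clear; lia.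
  move: cs; rewrite /= -catA rcons_cat !cat_path /= !rcons_path /=.
  rewrite cat_path last_cat /= => /and5P[w1 w'1 w'c /and3P[pr2 _ pt] tw].
  by rewrite xn' cat_path pr2 lu /= adj_sym wu cat_path w1 /= w'1 w'u pt /= !last_cat /=
    last_cat /= adj_sym xp.
have [r1 [r2 E]] : exists r1 r2, t = r1 ++ w' :: r2.
  by case/splitPr: w't => r1 r2; exists r1, r2.
rewrite {}E in gs Ks prevs Us cs.
have pw' : prev K w' = last b r1 by rewrite prevs; apply: (@prev_cat _ (w :: a :: s)).
rewrite pw' in xp'.
(* With [w'] beyond [b]: x, next w, ..., u, w, prev w, backwards to w', then b, ..., prev w', x. *)
apply: (@no_insertion K x (x :: (a :: s) ++ w :: rev (w' :: r2) ++ b :: r1)) => //.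
  rewrite perm_cons perm_sym; apply: perm_trans Ks _.
  by apply/seq.permP=> p; rewrite /= !count_cat /= !count_cat /= count_rev /=; clear; lia.
move: cs lu; rewrite /= rcons_cat !cat_path /= rcons_cat cat_path rcons_path.
case/and5P=> wa pas ab pr1 /andP[/= /andP[_ pr2] w'w] lu.
rewrite xn /= rcons_cat cat_path pas lu /= adj_sym wu /= rcons_cat cat_path.
rewrite path_rev_cons; last exact: adj_sym.
by rewrite rcons_path pr2 w'w rev_cons last_rcons /= w'u rcons_path pr1 adj_sym xp'.
Qed.

(** * The class Z of outside vertices and slots *)

Definition in_class K z := (z \notin K) || [exists x, (x \notin K) && slot K x z].

Lemma in_classP K z :
  reflect (z \notin K \/ exists2 x, x \notin K & slot K x z) (in_class K z).
Proof.
apply: (iffP orP) => [[|/existsP[x /andP[xK sz]]]|[|[x xK sz]]]; [by left| |by left|].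
  by right; exists x.
by right; apply/existsP; exists x; rewrite xK.
Qed.

Lemma in_class_rev K z : uniq K -> in_class (rev K) z = in_class K z.
Proof.
move=> UK; rewrite /in_class mem_rev; congr (_ || _).
by apply: eq_existsb => x; rewrite mem_rev slot_rev.
Qed.

(** If [z] is a slot of some [x] other than [y], exchanging them puts [z] and [y] both off the
    cycle, where [kcycle_consecutive] applies. *)
Lemma no_outside_class K y z u : kcycle K -> y \notin K -> in_class K z ->
  u \in K -> adj G z u -> adj G y (next K u) -> False.
Proof.
move=> gK yK /in_classP[zK|[x xK sz]] uK zu yu.
  exact: (kcycle_consecutive gK zK yK uK zu).
have [yx|yx] := eqVneq y x.
  by rewrite yx in yu; apply: (no_slot_outside gK xK sz uK zu yu).
have zK : z \in K by case/and3P: sz.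
have uz : u != z by apply: contraTneq zu => ->; rewrite adj_irr.
have nuz : next K u != z.
  by apply: contraTneq (slot_outside gK xK sz yK) => <-; rewrite adj_sym yu.
have UK := kcycle_uniq gK.
apply: (@kcycle_consecutive (swap z x K) z y u) => //.
- exact: kcycle_swap.
- rewrite mem_swap // eqxx /= orbF; apply: contraNneq xK => <-; exact: zK.
- by rewrite mem_swap // negb_or yx (negbTE yK) andbF.
- by rewrite mem_swap // uz uK orbT.
by rewrite next_swap.
Qed.

Lemma no_class_outside K y z u : kcycle K -> y \notin K -> in_class K z ->
  u \in K -> adj G y u -> adj G z (next K u) -> False.
Proof.
move=> gK yK zK uK yu zu; have UK := kcycle_uniq gK.
apply: (@no_outside_class (rev K) y z (next K u)) => //.
- exact: kcycle_rev.
- by rewrite mem_rev.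
- by rewrite in_class_rev.
- by rewrite mem_rev mem_next.
by rewrite next_rev // prev_next.
Qed.

(** Exchanging [z] with the vertex [x] of which it is a slot moves [z] off the cycle, which reduces
    to the cases already treated. Two distinct slots of the same [x] need the direct rerouting. *)
Lemma no_class_class K z z' u : kcycle K -> in_class K z -> in_class K z' ->
  u \in K -> adj G z u -> adj G z' (next K u) -> False.
Proof.
move=> gK cz cz' uK zu z'u; have UK := kcycle_uniq gK.
have /in_classP[zK|[x xK sz]] := cz.
  exact: (no_class_outside gK zK cz' uK zu).
have /in_classP[z'K|[x' x'K sz']] := cz'.
  exact: (no_outside_class gK z'K cz uK zu).
have zK : z \in K by case/and3P: sz.
have [z'K xp' xn'] := and3P sz'.
have uz : u != z by apply: contraTneq zu => ->; rewrite adj_irr.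
have zx : z != x by apply: contraNneq xK => <-.
have gS := kcycle_swap gK xK sz.
have zS : z \notin swap z x K by rewrite mem_swap // eqxx orbF.
have uS : u \in swap z x K by rewrite mem_swap // uz uK orbT.
have [zz'|zz'] := eqVneq z z'.
  apply: (@kcycle_consecutive (swap z x K) z z' u) => //; first by rewrite -zz'.
  rewrite next_swap //; apply: contraTneq z'u => ->.
  by rewrite -zz' adj_irr.
have [xx'|xx'] := eqVneq x x'.
  by rewrite -xx' in sz'; apply: (no_slot_slot_consecutive gK xK sz sz' zz' uK).
have x'z v : adj G x' v -> v != z.
  by apply: contraTneq => ->; rewrite adj_sym (slot_outside gK xK sz).
have z'nz : z' != z by rewrite eq_sym.
(* The neighbours of [z'] on [K] are neighbours of [x'], so they differ from [z] and the exchange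
   keeps them. *)
have sz'S : slot (swap z x K) x' z'.
  have pz := x'z _ xp'; have nz := x'z _ xn'.
  by rewrite /slot mem_swap // z'nz z'K orbT prev_swap // next_swap // xp'.
have x'S : x' \notin swap z x K by rewrite mem_swap // (negbTE x'K) andbF orbF eq_sym.
have z'z : ~~ adj G z' z := slot_outside gS x'S sz'S zS.
apply: (@no_class_outside (swap z x K) z z' u) => //.
  by apply/in_classP; right; exists x'.
by rewrite next_swap //; apply: contraNneq z'z => <-.
Qed.

Lemma in_class_nbr K z u : kcycle K -> in_class K z -> adj G z u -> u \in K.
Proof.
move=> gK cz; apply: contraTT => uK; case/in_classP: cz => [zK|[x xK sz]].
  exact: kcycle_outside gK zK uK.
exact: slot_outside gK xK sz uK.
Qed.

(** If z ~ z', then [z'] is on [K] and a slot of some [x]. So [x] is adjacent to the predecessor of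
    [z'] and [z] to [z'] itself, which are consecutive. *)
Lemma in_class_stable K z z' : kcycle K -> in_class K z -> in_class K z' -> ~~ adj G z z'.
Proof.
move=> gK cz cz'; apply/negP=> zz'; have z'K := in_class_nbr gK cz zz'.
case/in_classP: (cz') => [|[x xK /and3P[_ xp xn]]]; first by rewrite z'K.
have cx : in_class K x by rewrite /in_class xK.
apply: (no_class_class gK cx cz (u := prev K z')) => //; first by rewrite mem_prev.
by rewrite next_prev ?kcycle_uniq.
Qed.

Lemma broom_of_dominating K c : kcycle K -> c \in K ->
  (forall y, y \notin K -> adj G c y) -> has_spanning_broom G.
Proof.
move=> gK cK dom; have [s [gs Ks _ _]] := kcycle_rot gK cK.
case/andP: gs => /andP[/= + Us] _; rewrite rcons_path => /andP[ps _].
by apply: (spanning_broom_path ps Us) => y; rewrite -Ks; apply: dom.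
Qed.

(** Exchanging a missed [x] with one of its slots [w] adjacent to [c] lowers the number of missed
    vertices, while each other missed vertex loses at most the slot [w]. [Z] stays fixed while [K]
    changes. *)
Lemma broom_by_swaps q K (Z : {set T}) c : kcycle K -> c \in K ->
  (forall z z', z \in Z -> z' \in Z -> ~~ adj G z z') ->
  (forall y, y \notin K -> y \in Z) ->
  #|[set y | (y \notin K) && ~~ adj G c y]| <= q ->
  (forall y, y \notin K -> ~~ adj G c y ->
     q <= #|[set w in Z | adj G c w && slot K y w]|) ->
  has_spanning_broom G.
Proof.
move=> gK cK Zstable; elim: q K gK cK => [|q IHq] K gK cK KZ leq_q slots_q.
  apply: (broom_of_dominating gK cK) => y yK; apply: contraTT leq_q => cy.
  by rewrite -ltnNge card_gt0; apply/set0Pn; exists y; rewrite inE yK.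
have [/existsP[x /andP[xK cx]]|none] := boolP [exists y, (y \notin K) && ~~ adj G c y];
  last first.
  apply: (broom_of_dominating gK cK) => y yK; apply: contraNT none => cy.
  by apply/existsP; exists y; rewrite yK.
have : 0 < #|[set w in Z | adj G c w && slot K x w]| by apply: leq_trans (slots_q _ xK cx).
rewrite card_gt0 => /set0Pn[w]; rewrite inE => /and3P[wZ cw sw].
have wK : w \in K by case/and3P: sw.
have UK := kcycle_uniq gK.
have outS y : y \notin swap w x K -> (y == w) || (y != x) && (y \notin K).
  by rewrite mem_swap // negb_or negb_and negbK; case: (y =P w) => //= _ /andP[-> ->].
apply: (IHq (swap w x K)).
- exact: kcycle_swap.
- rewrite mem_swap // cK andbT; apply/orP; right.
  by apply: contraTneq cw => ->; rewrite adj_irr.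
- by move=> y /outS /orP[/eqP->//|/andP[_ /KZ]].
- rewrite -ltnS; apply: leq_trans leq_q; apply: proper_card; apply/properP; split.
    apply/subsetP=> y; rewrite !inE => /andP[/outS /orP[/eqP->|/andP[_ ->]] //].
    by rewrite cw.
  exists x; rewrite !inE ?xK //.
  by rewrite mem_swap // eqxx.
move=> y /outS /orP[/eqP->|/andP[yx yK] cy]; first by rewrite cw.
(* Stability of [Z] keeps [w] out of the neighbourhood of [y], so the exchange does not touch the
   cycle neighbours of the other slots of [y]. *)
have yw v : adj G y v -> v != w.
  by apply: contraTneq => ->; apply: Zstable => //; apply: KZ.
have := slots_q y yK cy; rewrite (cardsD1 w) => leq1.
have {leq1} : q <= #|[set w in Z | adj G c w && slot K y w] :\ w|.
  by move: leq1; case: (w \in _) => /= leq1; [move: leq1 | apply: leq_trans leq1].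
move/leq_trans; apply; apply: subset_leq_card; apply/subsetP=> v.
rewrite !inE => /and4P[vw vZ cv /and3P[vK vp vn]]; rewrite vZ cv /=.
have pw := yw _ vp; have nw := yw _ vn.
by rewrite /slot mem_swap // vw vK orbT prev_swap // next_swap // vp.
Qed.

(** * Sizes of the class, its neighbourhood and the slot sets *)

Definition class K := [set z | in_class K z].
Definition class_nbrs K := [set u | [exists z in class K, adj G z u]].

Lemma class_nbrsP K u :
  reflect (exists2 z, in_class K z & adj G z u) (u \in class_nbrs K).
Proof.
by rewrite inE; apply: (iffP exists_inP) => -[z zc zu]; exists z => //; move: zc;
  rewrite inE.
Qed.

Lemma class_nbrs_sub K u : kcycle K -> u \in class_nbrs K -> u \in K.
Proof. by move=> gK /class_nbrsP[z cz]; apply: in_class_nbr gK cz. Qed.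

Lemma class_nbrs_next K u : kcycle K -> u \in class_nbrs K -> next K u \notin class_nbrs K.
Proof.
move=> gK uT; have uK := class_nbrs_sub gK uT.
apply/class_nbrsP=> -[z' cz' z'u]; case/class_nbrsP: uT => z cz zu.
exact: (no_class_class gK cz cz' uK zu z'u).
Qed.

Lemma adj_class_nbrs K z u : in_class K z -> adj G z u -> u \in class_nbrs K.
Proof. by move=> cz zu; apply/class_nbrsP; exists z. Qed.

Lemma card_kcycle K : kcycle K -> #|[set u in K]| = k.
Proof.
move=> gK; have UK := kcycle_uniq gK; case/andP: gK => _ /eqP <-.
by rewrite -(card_uniqP UK); apply: eq_card => u; rewrite inE.
Qed.

Lemma card_outside K : kcycle K -> k + #|[set u | u \notin K]| = #|T|.
Proof.
move=> gK; rewrite -(card_kcycle gK) -(cardC [set u in K]); congr (_ + _).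
by apply: eq_card => u; rewrite !inE.
Qed.

Lemma card_imset_next K (A : {set T}) : kcycle K -> #|next K @: A| = #|A|.
Proof. by move=> gK; apply: card_imset; apply: can_inj (prev_next (kcycle_uniq gK)). Qed.

(** The neighbourhood and its shift along [K] are disjoint subsets of [K]. *)
Lemma leq_class_nbrs K : kcycle K -> 2 * #|class_nbrs K| <= k.
Proof.
move=> gK; rewrite mul2n -addnn -{2}(card_imset_next _ gK) -cardsUI.
rewrite [X in _ + X](_ : _ = 0) ?addn0.
  rewrite -(card_kcycle gK); apply: subset_leq_card; apply/subsetP=> u.
  rewrite !inE => /orP[|/imsetP[v vT ->]].
    by rewrite -[[exists _ in _, _]](in_set (fun u => [exists z in class K, adj G z u]));
      apply: class_nbrs_sub.
  by rewrite mem_next class_nbrs_sub.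
apply/eqP; rewrite cards_eq0; apply/eqP/setP=> u; rewrite !inE; apply/negP.
case/andP=> uT /imsetP[v /(class_nbrs_next gK) + uv].
by rewrite -uv inE uT.
Qed.

(** Each slot is the successor of a vertex of the neighbourhood of the class. *)
Lemma leq_class K : kcycle K -> #|class K| + k <= #|T| + #|class_nbrs K|.
Proof.
move=> gK; rewrite -(card_outside gK) -(card_imset_next (class_nbrs K) gK).
suff /subset_leq_card : class K \subset [set u | u \notin K] :|: next K @: class_nbrs K.
  by move/leq_trans/(_ (leq_card_setU _ _)); lia.
apply/subsetP=> z; rewrite [z \in class _]inE => /in_classP[zK|[x xK sz]].
  by rewrite !inE zK.
rewrite inE; apply/orP; right; apply/imsetP; exists (prev K z).
  case/and3P: sz => _ xp _; apply: adj_class_nbrs xp.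
  by rewrite /in_class xK.
by rewrite next_prev ?kcycle_uniq.
Qed.

(** Let C be the neighbourhood of [x]. The successors of the slots of [x] include the intersection
    of C with its shift by two. Both sets avoid the shift by one of [class_nbrs K], so their union
    has at most k - t elements, where t is the size of [class_nbrs K]. *)
Lemma leq_slots K x : kcycle K -> x \notin K ->
  #|class_nbrs K| + 2 * degree G x <= k + #|[set w | slot K x w]|.
Proof.
move=> gK xK; have UK := kcycle_uniq gK.
set C := [set u | adj G x u]; pose f := next K.
have cx : in_class K x by rewrite /in_class xK.
have CT : C \subset class_nbrs K.
  by apply/subsetP=> u; rewrite inE; apply: adj_class_nbrs.
have slots : #|C :&: f @: (f @: C)| <= #|[set w | slot K x w]|.
  rewrite -(card_imset_next [set w | slot K x w] gK); apply: subset_leq_card.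
  apply/subsetP=> u; rewrite inE => /andP[xu /imsetP[w /imsetP[v xv wv] uw]].
  apply/imsetP; exists w => //; rewrite inE in xu; rewrite inE in xv.
  rewrite inE /slot -[next K w]uw xu wv prev_next // xv mem_next !andbT.
  exact: in_class_nbr xv.
have sizes : #|C :|: f @: (f @: C)| + #|C :&: f @: (f @: C)| = 2 * degree G x.
  by rewrite cardsUI !card_imset_next // mul2n addnn.
suff : #|class_nbrs K| + #|C :|: f @: (f @: C)| <= k by lia.
rewrite -(card_imset_next (class_nbrs K) gK) -/f -cardsUI.
rewrite [X in _ + X](_ : _ = 0) ?addn0.
  rewrite -(card_kcycle gK); apply: subset_leq_card; apply/subsetP=> u.
  have TK v : v \in class_nbrs K -> v \in K by apply: class_nbrs_sub.
  rewrite !in_setU [u \in [set _ | _]]inE => /or3P[/imsetP[v vT ->]|/(subsetP CT)/TK//|].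
    by rewrite mem_next TK.
  by case/imsetP=> w /imsetP[v /(subsetP CT)/TK vK ->] ->; rewrite !mem_next.
apply/eqP; rewrite cards_eq0; apply/eqP/setP=> u; rewrite !in_setI in_set0; apply/negP.
rewrite in_setU => /andP[/imsetP[v vT ->] /orP[/(subsetP CT)|]].
  by apply/negP; apply: class_nbrs_next.
case/imsetP=> w /imsetP[v' /(subsetP CT) v'T ->] /(can_inj (prev_next UK)) e.
by have /negP := class_nbrs_next gK v'T; rewrite -/(f v') -e.
Qed.

Lemma card_class_nonadj K z : in_class K z ->
  #|[set u in class_nbrs K | ~~ adj G z u]| + degree G z = #|class_nbrs K|.
Proof.
move=> cz; rewrite addnC -(cardsID [set u | adj G z u] (class_nbrs K)); congr (_ + _).
  apply: eq_card => u; rewrite in_setI [u \in [set _ | _]]inE.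
  by apply/idP/andP => [zu|[]//]; split=> //; apply: adj_class_nbrs zu.
by apply: eq_card => u; rewrite in_setD !inE andbC.
Qed.

(** The vertices off [K] missed by [c] and the slots of [y] missed by [c] are disjoint sets of
    missed class vertices. Hence the slots of [y] adjacent to [c] are at least as many as the missed
    vertices off [K]. *)
Lemma broom_of_center K c : kcycle K -> c \in class_nbrs K ->
  (forall x, x \notin K -> ~~ adj G c x ->
     #|[set z in class K | ~~ adj G c z]| <= #|[set w | slot K x w]|) ->
  has_spanning_broom G.
Proof.
move=> gK cT le_slots.
apply: (@broom_by_swaps #|[set y | (y \notin K) && ~~ adj G c y]| K (class K) c) => //.
- exact: class_nbrs_sub cT.
- by move=> z z'; rewrite !inE; apply: in_class_stable.
- by move=> y yK; rewrite inE /in_class yK.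
move=> y yK cy; have := le_slots y yK cy.
rewrite -(cardsID [set w | adj G c w] [set w | slot K y w]) => le1.
have le2 : #|[set y | (y \notin K) && ~~ adj G c y]| + #|[set w | slot K y w] :\: [set w
  | adj G c w]|
   <= #|[set z in class K | ~~ adj G c z]|.
  rewrite -cardsUI [X in _ + X](_ : _ = 0) ?addn0.
    apply: subset_leq_card; apply/subsetP=> v; rewrite !inE /in_class.
    case/orP=> [/andP[-> ->]//|/andP[-> sv]].
    by rewrite andbT; apply/orP; right; apply/existsP; exists y; rewrite yK.
  apply/eqP; rewrite cards_eq0; apply/eqP/setP=> v; rewrite !inE; apply/negP.
  by case/and3P=> /andP[vK _] _ /and3P[]; rewrite (negbTE vK).
have le3 : #|[set w | slot K y w] :&: [set w | adj G c w]| <=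
   #|[set w in class K | adj G c w && slot K y w]|.
  apply: subset_leq_card; apply/subsetP=> v; rewrite !inE => /andP[sv ->].
  by rewrite sv /= andbT /in_class; apply/orP; right; apply/existsP; exists y; rewrite yK.
lia.
Qed.

(* [m] stands for the least admissible value of sigma2, rounded up. *)
Context (m : nat) (leq_m : 2 * #|T| <= 3 * m + 3).
Context (ore : forall u v, u != v -> ~~ adj G u v -> m <= degree G u + degree G v).

(** * Choice of the center by averaging *)

Lemma class_stable K z z' : kcycle K -> z \in class K -> z' \in class K -> ~~ adj G z z'.
Proof. by move=> gK; rewrite !inE; apply: in_class_stable. Qed.

Lemma class_gt1 K : kcycle K -> 1 < #|class K|.
Proof.
move=> gK; have := card_outside gK => cK.
apply: leq_trans (_ : #|[set u | u \notin K]| <= _); first by lia.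
by apply: subset_leq_card; apply/subsetP=> u; rewrite !inE /in_class => ->.
Qed.

(** A vertex [z0] of degree below m / 2 is paired with some [z1], and together they reach [m]; all
    the others have degree above m / 2. *)
Lemma leq_sum_degree_class K : kcycle K ->
  #|class K| * m <= 2 * \sum_(z in class K) degree G z.
Proof.
move=> gK; have Z2 := class_gt1 gK.
have [[z0 /andP[z0Z lt0]]|noz] := altP (@existsP _ [pred z | (z \in class K) && (2 *
  degree G z < m)]); last first.
  rewrite -sum_nat_const big_distrr /=; apply: leq_sum => z zZ.
  by have := existsPn noz z; rewrite /= zZ /= -leqNgt.
have other z : z \in class K -> z != z0 -> m <= degree G z0 + degree G z.
  by move=> zZ zz0; apply: ore; rewrite 1?eq_sym //; apply: class_stable gK _ _.
have [z1 /andP[z1Z z10]] : exists z1, (z1 \in class K) && (z1 != z0).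
  have : 0 < #|class K :\ z0| by move: Z2; rewrite (cardsD1 z0) z0Z.
  by rewrite card_gt0 => /set0Pn[z1]; rewrite in_setD1 andbC => ?; exists z1.
rewrite (bigD1 z0) //= (bigD1 z1) /= ?z1Z //.
have := other z1 z1Z z10.
have : #|class K| = (\sum_(i | (i \in class K) && (i != z0) && (i != z1)) 1).+2.
  by rewrite -sum1_card (bigD1 z0) //= (bigD1 z1) /= ?z1Z // !add1n.
have : (\sum_(i | (i \in class K) && (i != z0) && (i != z1)) 1) * m <=
   2 * \sum_(i | (i \in class K) && (i != z0) && (i != z1)) degree G i.
  rewrite big_distrl big_distrr /=; apply: leq_sum => z /andP[/andP[zZ zz0] _].
  by have := other z zZ zz0; rewrite mul1n; move: lt0; clear; rewrite /=; lia.
move: (\sum_(i | _) 1) => A; move: (\sum_(i | _) _) => B.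
by move=> AB -> h; move: AB h; rewrite !mulSn; clear; lia.
Qed.

Lemma broom_of_high_outside K : kcycle K ->
  (forall x, x \notin K -> m <= 2 * degree G x) -> has_spanning_broom G.
Proof.
move=> gK high; have Z2 := class_gt1 gK; have sumZ := leq_sum_degree_class gK.
have [x0 x0K] : exists x, x \notin K.
  have : 0 < #|[set u | u \notin K]| by have := card_outside gK; lia.
  by rewrite card_gt0 => /set0Pn[x]; rewrite inE => ?; exists x.
have m_gt0 : 0 < m by lia.
have Tn0 : class_nbrs K != set0.
  have : 0 < degree G x0 by have := high x0 x0K; lia.
  rewrite card_gt0 => /set0Pn[u]; rewrite inE => x0u.
  by apply/set0Pn; exists u; apply: adj_class_nbrs x0u; rewrite /in_class x0K.
have [c cT] := exists_leq_average (fun c z => ~~ adj G c z) (class K) Tn0.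
(* All neighbours of a class vertex lie in [class_nbrs K], so its degree determines how many
   vertices there it misses. *)
rewrite (eq_bigr (fun z => #|class_nbrs K| - degree G z)); last first.
  move=> z; rewrite inE => cz; rewrite -(card_class_nonadj cz) addnK.
  by apply: eq_card => u; rewrite !inE adj_sym.
move=> avg; apply: (broom_of_center gK cT) => x xK _.
have sumE : \sum_(z in class K) (#|class_nbrs K| - degree G z) + \sum_(z in class K)
  degree G z
   = #|class K| * #|class_nbrs K|.
  rewrite -big_split -sum_nat_const; apply: eq_bigr => z; rewrite inE => cz /=.
  by rewrite subnK // -(card_class_nonadj cz) leq_addl.
apply: (@swap_count_generic #|T| k m #|class_nbrs K| #|class K| _ _ (degree G x)
  (\sum_(z in class K) degree G z)) => //.
- exact: leq_class_nbrs.
- exact: leq_class.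
- exact: ltnW.
- by rewrite -sumE leq_add2r.
- exact: leq_slots.
- exact: high.
Qed.

Lemma broom_of_kcycle K : kcycle K -> has_spanning_broom G.
Proof.
move=> gK; have UK := kcycle_uniq gK.
have [/existsP[x0 /andP[x0K low]]|none] :=
    boolP [exists x, (x \notin K) && (2 * degree G x < m)]; last first.
  apply: (broom_of_high_outside gK) => x xK; rewrite leqNgt.
  by have := existsPn none x; rewrite xK.
have cx0 : in_class K x0 by rewrite /in_class x0K.
have other z : in_class K z -> z != x0 -> m <= degree G z + degree G x0.
  by move=> cz zx0; apply: ore => //; apply: in_class_stable gK _ _.
(* If [x0] has a slot, it is exchanged into the cycle; then every outside vertex differs from [x0]
   and has degree above m / 2. *)
have [sl0|] := eqVneq [set w | slot K x0 w] set0; last first.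
  case/set0Pn=> w; rewrite inE => sw; have wK : w \in K by case/and3P: sw.
  apply: (@broom_of_high_outside (swap w x0 K)); first exact: kcycle_swap.
  move=> y; rewrite mem_swap // negb_or negb_and negbK => /andP[yx0 yw].
  have cy : in_class K y.
    apply/in_classP; case/orP: yw => [/eqP->|yK]; [right; exists x0 | left] => //.
  have := other y cy yx0; move: low; clear; lia.
have d0_gt0 : 0 < degree G x0.
  have [y yx0] : exists y, y != x0.
    have : 0 < #|[set: T] :\ x0| by have := cardsT T; rewrite (cardsD1 x0) inE; lia.
    by rewrite card_gt0 => /set0Pn[y]; rewrite !inE andbT => ?; exists y.
  have [u [v [/eqP-> _ uv]]] : exists u v, [/\ u \in pred1 x0, v \notin pred1 x0 & adj G
    u v].
    by apply: (@connected_cut _ G conn _ x0 y); rewrite inE ?eqxx.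
  by rewrite card_gt0; apply/set0Pn; exists v; rewrite inE.
(* With no slot for [x0], the averaging is restricted to the neighbours of [x0]. *)
have A0 : [set u | adj G x0 u] != set0 by rewrite -card_gt0.
have [c cA avg] := exists_leq_average (fun c z => ~~ adj G c z) (class K) A0.
have cx0' : adj G x0 c by rewrite inE in cA.
apply: (broom_of_center gK (adj_class_nbrs cx0 cx0')) => x xK cx.
have xx0 : x != x0 by apply: contraNneq cx => ->; rewrite adj_sym.
have cxx : in_class K x by rewrite /in_class xK.
have dx := other x cxx xx0.
have dxT : degree G x <= #|class_nbrs K| by rewrite -(card_class_nonadj cxx) leq_addl.
(* Any other class vertex has degree at least m - d(x0), so it misses at most [y] vertices of
   [class_nbrs K]. As [x0] misses none of its own neighbours, the count below has one term less. *)
pose y := #|class_nbrs K| + degree G x0 - m.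
apply: (@swap_count_low #|T| k m #|class_nbrs K| #|class K| _ _ (degree G x) (degree G
  x0) y) => //.
- exact: leq_class_nbrs.
- exact: leq_class.
- by have := leq_slots gK x0K; rewrite sl0 cards0 addn0.
- by rewrite /y subnK //; move: dx dxT; clear; lia.
- apply: leq_trans avg _.
  rewrite (bigD1 x0) /=; last by rewrite inE.
  rewrite [X in X + _](_ : _ = 0) ?add0n; last first.
    by apply/eqP; rewrite cards_eq0; apply/eqP/setP=> u; rewrite !inE adj_sym andbN.
  have -> : #|class K|.-1 = \sum_(z in class K | z != x0) 1.
    by rewrite -sum1_card (bigD1 x0) ?inE.
  rewrite big_distrl /=; apply: leq_sum => z /andP[]; rewrite inE => cz zx0; rewrite mul1n.
  have dz := other z cz zx0; have eT := card_class_nonadj cz.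
  have : #|[set u in [set u | adj G x0 u] | ~~ adj G u z]| <= #|[set u in class_nbrs K |
    ~~ adj G z u]|.
    apply: subset_leq_card; apply/subsetP=> u; rewrite !inE => /andP[xu uz].
    rewrite adj_sym uz andbT.
    by apply/exists_inP; exists x0; rewrite ?inE.
  rewrite /y; move: dz eT; clear; lia.
- exact: leq_slots.
Qed.

End NearLongestCycle.

(** * The two cases combined *)

Lemma longest_exists {T : finType} (G : sgraph T) (x : T) : exists P, longest G P.
Proof.
pose p k := [exists t : k.-tuple T, upath G t].
have p_ex : exists k, p k by exists 1; apply/existsP; exists [tuple x].
have p_bound k : p k -> k <= #|T|.
  case/existsP=> t /andP[_ Ut]; rewrite -(size_tuple t) -(card_uniqP Ut); exact: max_card.
case: (ex_maxnP p_ex p_bound) => k /existsP[t ut] k_max.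
exists t; split=> // s us; rewrite size_tuple; apply: k_max.
by apply/existsP; exists (in_tuple s).
Qed.

Theorem theorem1p5 (n : nat) (T : finType) (G : sgraph T) :
  13 <= n ->
  #|T| = n ->
  connected_graph G ->
  (((2 * n%:R - 3) / 3)%R%:E <= sigma2 G)%E ->
  has_spanning_broom G.
Proof.
move=> n_ge13 cardT conn /sigma2_geP le_sigma2.
(* Denominators are cleared and the 3 is moved to the right, which avoids truncated subtraction. *)
have ore u v : u != v -> ~~ adj G u v -> 2 * #|T| <= 3 * (degree G u + degree G v) + 3.
  move=> uv nuv; have := le_sigma2 u v uv nuv.
  rewrite Num.Theory.ler_pdivrMr // Num.Theory.lerBlDr -!GRing.natrM -GRing.natrD.
  by rewrite Num.Theory.ler_nat mulnC cardT [_ * 3]mulnC [n * 2]mulnC.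
have /card_gt0P[x0 _] : 0 < #|T| by rewrite cardT; apply: leq_trans n_ge13.
have [P lP] := longest_exists G x0.
have [/existsP[x xP]|spanning] := boolP [exists x, x \notin P]; last first.
  have allP y : y \in P by have := existsPn spanning y; rewrite negbK.
  have [/andP[sP UP] _] := lP.
  case: P sP UP allP {lP spanning} => [|c p] sP UP allP; first by have := allP x0.
  by apply: (spanning_broom_path sP UP) => y; rewrite allP.
have [/existsP[K cK]|nocyc] :=
    boolP [exists K : (size P).-1.-tuple T, (2 < (size P).-1) && ucycleb (adj G) K];
      last first.
  apply: (broom_of_longest_path conn ore lP xP) => K cK K_gt2; apply/eqP => szK.
  case/existsP: nocyc; rewrite -szK; exists (in_tuple K).
  by rewrite K_gt2.
case/andP: cK => k_gt2 cK; have [/andP[_ UP] maxP] := lP.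
have szP : (size P).-1.+1 = size P by rewrite prednK //; apply: leq_trans (leq_pred _);
  apply: leq_trans k_gt2.
have ltP : size P < #|T|.
  rewrite -(card_uniqP UP); apply: proper_card; apply/properP; split; first exact/subsetP.
  by exists x.
(* The value of [m] is the ceiling of (2n - 3) / 3. *)
apply: (@broom_of_kcycle _ G conn (size P).-1 k_gt2 _ _ ((2 * #|T| - 1) %/ 3) _ _ K).
- by rewrite szP.
- by rewrite szP; apply: maxP.
- by clear; lia.
- by move=> u v uv nuv; have := ore u v uv nuv; clear; lia.
by rewrite /kcycle cK size_tuple eqxx.
Qed.
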